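(* Let $G$ be a second countable étale groupoid whose unit space $G^{(0)}$ is compact and totally disconnected, and suppose $G$ is almost finite and minimal. For clopen subsets $U,V\subset G^{(0)}$, the following are equivalent: (1) there exists $\gamma\in[G]$ with $\gamma(U)=V$; (2) $\mu(U)=\mu(V)$ for all $\mu\in M(G)$. Moreover, $\gamma$ in (1) can be chosen so that $\gamma^2=\mathrm{id}$ and $\gamma(x)=x$ for $x\in G^{(0)}\setminus(U\cup V)$.
   Context: An étale groupoid is a locally compact Hausdorff groupoid whose range map $r$ is a local homeomorphism; $s$ is the source map. The full group $[G]$ is the group of homeomorphisms $\gamma$ of $G^{(0)}$ such that for every $x\in G^{(0)}$ there is $g\in G$ with $r(g)=x$ and $s(g)=\gamma(x)$. A $G$-set is $U\subset G$ with $r|_U,s|_U$ injective. $M(G)$ is the set of probability measures $\mu$ on $G^{(0)}$ with $\mu(r(U))=\mu(s(U))$ for every open $G$-set $U$. $G$ is minimal if every orbit $r(s^{-1}(x))$ is dense. Elementary subgroupoid: compact open principal subgroupoid $K$ with $K^{(0)}=G^{(0)}$. $G$ is almost finite if for every compact $C\subset G$ and $\varepsilon>0$ there is an elementary subgroupoid $K$ with $|CKx\setminus Kx|/|K(x)|<\varepsilon$ for all $x$, where $Kx=\{k\in K:s(k)=x\}$, $CKx=\{ck:c\in C,k\in Kx,s(c)=r(k)\}$, $K(x)=r(Kx)$. *)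

(* Defs.v *)
From HB Require Import structures.
From mathcomp Require Import all_boot all_order all_algebra.
From mathcomp Require Import finmap.
From mathcomp Require Import all_classical all_reals all_analysis.
Set Implicit Arguments. Unset Strict Implicit. Unset Printing Implicit Defensive.
Import Order.TTheory GRing.Theory Num.Theory.
Local Open Scope classical_set_scope.
Local Open Scope ring_scope.

(* A topological groupoid is presented by its arrow space G, its unit space
   G0 (a separate topological space, embedded in G by [u]), range and source
   maps r s : G -> G0, a multiplication [mul] (meaningful on composable pairs
   (g,h) with s g = r h; g h goes from s h to r g) and an inverse [inv]. *)

Section Groupoid.
Context {G G0 : topologicalType}.
Variables (r s : G -> G0) (u : G0 -> G) (mul : G -> G -> G) (inv : G -> G).

Definition composable : set (G * G) := [set p | s p.1 = r p.2].

Record is_groupoid : Prop := {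
  gpd_r_unit : forall x, r (u x) = x;
  gpd_s_unit : forall x, s (u x) = x;
  gpd_r_mul : forall g h, s g = r h -> r (mul g h) = r g;
  gpd_s_mul : forall g h, s g = r h -> s (mul g h) = s h;
  gpd_mulA : forall g h k, s g = r h -> s h = r k ->
     mul (mul g h) k = mul g (mul h k);
  gpd_mul_unitl : forall g, mul (u (r g)) g = g;
  gpd_mul_unitr : forall g, mul g (u (s g)) = g;
  gpd_r_inv : forall g, r (inv g) = s g;
  gpd_s_inv : forall g, s (inv g) = r g;
  gpd_mulV : forall g, mul g (inv g) = u (r g);
  gpd_mulVg : forall g, mul (inv g) g = u (s g) }.

Definition local_homeomorphism {X Y : topologicalType} (f : X -> Y) :=
  continuous f /\
  forall x, exists U : set X, [/\ open U, U x, open (f @` U),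
     set_inj U f & forall V, V `<=` U -> open V -> open (f @` V)].

Record is_etale_groupoid : Prop := {
  etale_groupoid : is_groupoid;
  etale_hausdorff : hausdorff_space G;
  etale_locally_compact : locally_compact [set: G];
  etale_mul_cont : {within composable, continuous (fun p => mul p.1 p.2)};
  etale_inv_cont : continuous inv;
  etale_s_cont : continuous s;
  etale_u_cont : continuous u;
  etale_r_local_homeo : local_homeomorphism r }.

Definition Gset (U : set G) := set_inj U r /\ set_inj U s.

Definition is_homeomorphism {X : topologicalType} (f : X -> X) :=
  continuous f /\ exists g : X -> X, [/\ cancel f g, cancel g f & continuous g].

Definition full_group (gamma : G0 -> G0) :=
  is_homeomorphism gamma /\
  forall x, exists g, r g = x /\ s g = gamma x.

Definition minimal_groupoid :=
  forall x, closure (r @` (s @^-1` [set x])) = [set: G0].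

Definition elementary_subgroupoid (K : set G) :=
  [/\ compact K, open K,
      (forall x, K (u x)),
      (forall g h, K g -> K h -> s g = r h -> K (mul g h)) &
      (forall g, K g -> K (inv g))] /\
  (forall k1 k2, K k1 -> K k2 -> r k1 = r k2 -> s k1 = s k2 -> k1 = k2).

Definition Kfib (K : set G) (x : G0) : set G := [set k | K k /\ s k = x].
Definition Kprod (C : set G) (K : set G) (x : G0) : set G :=
  [set g | exists c k, [/\ C c, Kfib K x k, s c = r k & g = mul c k]].
Definition Korbit (K : set G) (x : G0) : set G0 := r @` Kfib K x.

Definition scard {T : choiceType} (A : set T) : nat := #|` fset_set A|%fset.

Definition almost_finite (R : realType) :=
  forall (C : set G) (eps : R), compact C -> 0 < eps ->
  exists K, elementary_subgroupoid K /\
   forall x : G0,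
     (scard (Kprod C K x `\` Kfib K x))%:R / (scard (Korbit K x))%:R < eps.

End Groupoid.

Notation Borel T := (g_sigma_algebraType (@open T)).

Definition invariant_measure {G : topologicalType} {G0 : ptopologicalType} (R : realType)
  (r s : G -> G0) (mu : probability (Borel G0) R) :=
  forall U : set G, open U -> Gset r s U -> mu (r @` U) = mu (s @` U).

(* Main.v *)
Require Import Defs.
From HB Require Import structures.
From mathcomp Require Import all_boot all_order all_algebra.
From mathcomp Require Import finmap lra.
From mathcomp Require Import all_classical all_reals all_analysis.
Set Implicit Arguments. Unset Strict Implicit. Unset Printing Implicit Defensive.
Import Order.TTheory GRing.Theory Num.Theory numFieldNormedType.Exports.
Local Open Scope classical_set_scope.
Local Open Scope ring_scope.

(* Comparison: if [mu U < mu V] for every invariant [mu], then some elementary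
   subgroupoid [K] has [#(U \cap K(x)) < #(V \cap K(x))] for all [x]; otherwise
   the uniform measures on bad orbits [K(x)], for better and better [K], have an
   invariant limit with [mu V <= mu U].  Inside such a [K] a greedy matching
   yields a compact open [G]-set carrying [U] into [V].

   Equal measures: pick [x0] in [U] and [y0] in [V] on one orbit.  In the absence
   of isolated points, small neighbourhoods of [y0] have measure strictly below
   that of any given nonempty clopen set, so the comparison result matches [U]
   and [V], back and forth, up to clopen remainders shrinking to [x0] and [y0];
   sending [x0] to [y0] completes a homeomorphism.  If there is an isolated
   point, the unit space is finite and a greedy matching is enough.

   Conversely, an element of the full group is, on each piece of a countable
   Borel partition, given by an open [G]-set, so it preserves invariant
   measures. *)

(** * Clopen sets in compact totally disconnected Hausdorff spaces *)

Section Topology.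
Context {T : topologicalType}.
Implicit Types (K S U V D : set T) (x y : T).

(** If [P K] failed, the sets whose complement in [K] satisfies [P] would form a proper filter
    containing [K], and the locality hypothesis would rule out each of its cluster points in [K]. *)
Lemma compact_ind K (P : set T -> Prop) : compact K ->
  P set0 -> (forall A B, A `<=` B -> P B -> P A) ->
  (forall A B, P A -> P B -> P (A `|` B)) ->
  (forall x, K x -> exists O, [/\ open O, O x & P O]) -> P K.
Proof.
move=> cK P0 Psub PU Ploc; apply: contrapT => nPK.
pose F : set_system T := [set A | P (K `\` A)].
have FF : ProperFilter F.
  split; first by rewrite /F /= setD0.
  split; first by rewrite /F /= setDT.
    by move=> A B FA FB; rewrite /F /= setDIr; exact: PU.
  by move=> A B AB; apply: Psub; exact: setDS.
have FK : F K by rewrite /F /= setDv.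
have [x [Kx clx]] := cK F FF FK.
have [N [oN Nx PN]] := Ploc x Kx.
have FN : F (~` N) by apply: Psub PN => y [_ /contrapT].
by have [y []] := clx _ _ FN (open_nbhs_nbhs (conj oN Nx)).
Qed.

Lemma clopenD U V : clopen U -> clopen V -> clopen (U `\` V).
Proof. by move=> cU cV; rewrite setDE; apply: clopenI => //; exact: clopenC. Qed.

(** By compactness finitely many of the separating clopen sets suffice, and their intersection does
    the job. *)
Lemma separate_quasicomponent x S : compact S ->
  (forall y, S y -> exists D, [/\ clopen D, D x & ~ D y]) ->
  exists D, [/\ clopen D, D x & D `<=` ~` S].
Proof.
move=> cS sepS.
apply: (@compact_ind S (fun S => exists D, [/\ clopen D, D x & D `<=` ~` S]) cS).
- by exists setT; split=> //; [exact: clopenT|rewrite setC0].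
- move=> A B AB [D [cD Dx DB]]; exists D; split=> //.
  exact: (subset_trans DB (subsetC AB)).
- move=> A B [D [cD Dx DA]] [E [cE Ex EB]]; exists (D `&` E); split=> //.
    exact: clopenI.
  by move=> y [Dy Ey] [Ay|By]; [exact: DA Ay|exact: EB By].
- move=> y /sepS[D [cD Dx Dy]]; exists (~` D); split=> //.
    by have [] := clopenC D cD.
  by exists D; split=> //; rewrite setCK.
Qed.

Lemma hausdorff_normal_sep (A B : set T) : hausdorff_space T ->
  compact [set: T] -> closed A -> closed B -> A `&` B = set0 ->
  exists U V, [/\ open U, open V, A `<=` U, B `<=` V & U `&` V = set0].
Proof.
move=> hT cT cA cB AB0; have nT := compact_normal hT cT.
have AcB : set_nbhs A (~` B).
  apply/set_nbhsP; exists (~` B); split=> //; first exact: closed_openC.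
  by move=> x Ax Bx; have : (A `&` B) x by []; rewrite AB0.
have [C /set_nbhsP[V [oV AV VC]] CB] := nT A cA _ AcB.
exists V, (~` closure C); split=> //.
- exact/closed_openC/closed_closure.
- by move=> x Bx /CB.
- by rewrite -subset0 => x [/VC/subset_closure].
Qed.

(** In a compact Hausdorff space the quasicomponent [Q] of [x] is connected, so here it reduces to
    [x]; compactness then puts one clopen neighbourhood of [x] inside [O]. *)
Lemma totally_disconnected_clopen_nbhs (O : set T) x : hausdorff_space T ->
  compact [set: T] -> totally_disconnected [set: T] -> open O -> O x ->
  exists D, [/\ clopen D, D x & D `<=` O].
Proof.
move=> hT cT tT oO Ox.
have clcompact S : closed S -> compact S.
  by move=> cS; apply: (subclosed_compact cS cT).
pose Q := \bigcap_(D in [set D | clopen D /\ D x]) D.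
have Qx : Q x by move=> D [].
have cQ : closed Q by apply: closed_bigI => D [[]].
have sepQ S : closed S -> S `&` Q = set0 ->
    exists D, [/\ clopen D, D x & D `<=` ~` S].
  move=> cS SQ; apply: separate_quasicomponent; first exact: clcompact.
  move=> y Sy; apply: contrapT => nD.
  have : (S `&` Q) y; last by rewrite SQ.
  split=> // D [cD Dx]; apply: contrapT => nDy; apply: nD.
  by exists D.
have conQ : connected Q.
  (* A splitting of [Q] into two closed pieces extends to disjoint open sets [A] and [B], and some
     clopen [D] around [x] lies in their union. The part of [D] on the side of [x] is clopen, hence
     contains all of [Q], although the piece on the other side is nonempty. *)
  apply: contrapT => /connectedPn[E [E0 QE [sep1 sep2]]].
  have QEb b : E b `<=` Q by rewrite QE; case: b => y; [right|left].
  have Edisj : E false `&` E true = set0.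
    by rewrite -subset0 -sep1; apply: setSI; exact: subset_closure.
  have clE b : closed (E b).
    move=> y cly; have : Q y.
      by rewrite (closure_id Q).1//; exact: (closure_subset (QEb b)).
    rewrite QE => -[]; case: b cly => // cly Ey.
      by exfalso; have : (E false `&` closure (E true)) y by []; rewrite sep2.
    by exfalso; have : (closure (E false) `&` E true) y by []; rewrite sep1.
  have [A [B [oA oB EA EB AB]]] := hausdorff_normal_sep hT cT (clE _) (clE _) Edisj.
  have clAB : closed (~` (A `|` B)) by apply/open_closedC/openU.
  have [|D [[oD cD] Dx]] := sepQ _ clAB.
    rewrite -subset0 => y [nAB]; rewrite QE => Ey; apply: nAB.
    by case: Ey => [/EA|/EB]; [left|right].
  rewrite setCK => DAB.
  have clopenDI (A' B' : set T) : open A' -> open B' -> D `<=` A' `|` B' ->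
      A' `&` B' = set0 -> clopen (D `&` A').
    move=> oA' oB' DU dis; split; first exact: openI.
    have -> : D `&` A' = D `&` ~` B'.
      apply/seteqP; split=> y [Dy Hy]; split=> //; last by case: (DU _ Dy).
      by move=> B'y; have : (A' `&` B') y by []; rewrite dis.
    by apply: closedI => //; exact: open_closedC.
  have contra (A' B' E' : set T) : open A' -> open B' -> D `<=` A' `|` B' ->
      A' `&` B' = set0 -> A' x -> E' !=set0 -> E' `<=` Q -> E' `<=` B' -> False.
    move=> oA' oB' DU dis A'x [y Ey] EQ EB'.
    have [_ A'y] : (D `&` A') y by apply: (EQ _ Ey); split; [exact: clopenDI DU _|].
    by have : (A' `&` B') y by [split=> //; exact: EB']; rewrite dis.
  move: (Qx); rewrite QE => -[/EA Ax|/EB Bx].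
    by apply: (contra A B (E true)).
  by apply: (contra B A (E false)) => //; rewrite 1?setUC 1?setIC.
have Q1 : Q `<=` [set x].
  by rewrite -(tT x I); exact: connected_component_max.
have [|D [cD Dx DO]] := sepQ (~` O) (open_closedC oO).
  by rewrite -subset0 => y [nOy /Q1 yx]; apply: nOy; rewrite yx.
by exists D; split=> //; rewrite setCK in DO.
Qed.

End Topology.

(** * Cardinalities of finite sets *)

Section Cardinal.
Implicit Types T U : choiceType.

Lemma le_scard T (A B : set T) : finite_set B -> A `<=` B -> (scard A <= scard B)%N.
Proof.
move=> fB AB; have fA := sub_finite_set AB fB.
by apply: fsubset_leq_card; rewrite -fset_set_sub.
Qed.

Lemma scard1 T (x : T) : scard [set x] = 1%N.
Proof. by rewrite /scard fset_set1 cardfs1. Qed.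

Lemma scardU T (A B : set T) : finite_set A -> finite_set B -> A `&` B = set0 ->
  scard (A `|` B) = (scard A + scard B)%N.
Proof.
move=> fA fB AB; rewrite /scard fset_setU// cardfsU -fset_setI// AB fset_set0.
by rewrite cardfs0 subn0.
Qed.

Lemma scardU_le T (A B : set T) : finite_set A -> finite_set B ->
  (scard (A `|` B) <= scard A + scard B)%N.
Proof. by move=> fA fB; rewrite /scard fset_setU// cardfsU leq_subr. Qed.

Lemma scard_gt0 T (A : set T) x : finite_set A -> A x -> (0 < scard A)%N.
Proof.
move=> fA Ax; rewrite -(scard1 x); apply: le_scard => // y ->; exact: Ax.
Qed.

Lemma scard_inj T U (A : set T) (B : set U) (f : T -> U) : finite_set A ->
  finite_set B -> set_inj A f -> f @` A `<=` B -> (scard A <= scard B)%N.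
Proof.
move=> fA fB injf fAB; have fi := finite_image f fA.
apply: leq_trans (le_scard fB fAB).
rewrite /scard fset_set_image// card_in_imfset// => x y.
rewrite !in_fset_set// => Ax Ay; exact: injf.
Qed.

End Cardinal.

(** * Compact open bisections of an étale groupoid, and greedy matching *)

Definition bisection {G G0 : topologicalType} (r s : G -> G0) (W : set G) :=
  [/\ compact W, open W & Gset r s W].

Section EtaleGroupoid.
Context {G : topologicalType} {G0 : ptopologicalType}.
Context {r s : G -> G0} {u : G0 -> G} {mul : G -> G -> G} {inv : G -> G}.
Context (etG : is_etale_groupoid r s u mul inv).
Implicit Types (W C K O : set G) (A B D U V N : set G0) (g h k : G) (x y : G0).

Let gG : is_groupoid r s u mul inv := etale_groupoid etG.

Lemma invK : involutive inv.
Proof.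
move=> g.
have E : s (inv (inv g)) = s g by rewrite (gpd_s_inv gG) (gpd_r_inv gG).
rewrite -[LHS](gpd_mul_unitr gG) E -(gpd_mulVg gG) -(gpd_mulA gG).
- by rewrite (gpd_mulVg gG) (gpd_s_inv gG) (gpd_mul_unitl gG).
- by rewrite (gpd_s_inv gG).
- by rewrite (gpd_s_inv gG).
Qed.

Lemma r_continuous : continuous r.
Proof. by have [] := etale_r_local_homeo etG. Qed.

Lemma s_continuous : continuous s.
Proof. exact: etale_s_cont etG. Qed.

Lemma inv_image W : inv @` W = inv @^-1` W.
Proof.
by apply/seteqP; split=> [_ [g Wg <-] /=|g Wg]; [rewrite invK|exists (inv g); rewrite ?invK].
Qed.

Lemma r_inv_image W : r @` (inv @` W) = s @` W.
Proof.
rewrite image_comp; congr image; apply/funext => g; exact: gpd_r_inv gG g.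
Qed.

Lemma s_inv_image W : s @` (inv @` W) = r @` W.
Proof.
rewrite image_comp; congr image; apply/funext => g; exact: gpd_s_inv gG g.
Qed.

Lemma r_open W : open W -> open (r @` W).
Proof.
move=> oW; rewrite openE => _ [g Wg <-].
have [_ /(_ g)[U [oU Ug _ _ oUr]]] := etale_r_local_homeo etG.
have : open (r @` (W `&` U)) by apply: oUr; [exact: subIsetr|exact: openI].
move=> oWU; have : nbhs (r g) (r @` (W `&` U)).
  by apply: open_nbhs_nbhs; split=> //; exists g.
by apply: filterS; exact: image_subset (@subIsetl _ _ _).
Qed.

Lemma inv_open W : open W -> open (inv @` W).
Proof.
by rewrite inv_image; move: W; apply/continuousP; exact: etale_inv_cont etG.
Qed.

Lemma s_open W : open W -> open (s @` W).
Proof. by move=> oW; rewrite -r_inv_image; exact/r_open/inv_open. Qed.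

Lemma open_preim_r A : open A -> open (r @^-1` A).
Proof. by move: A; apply/continuousP; exact: r_continuous. Qed.

Lemma open_preim_s A : open A -> open (s @^-1` A).
Proof. by move: A; apply/continuousP; exact: s_continuous. Qed.

Lemma clopen_preim_r A : clopen A -> clopen (r @^-1` A).
Proof.
move=> [oA cA]; split; first exact: open_preim_r.
by move: A cA {oA}; apply/continuous_closedP; exact: r_continuous.
Qed.

Lemma clopen_preim_s A : clopen A -> clopen (s @^-1` A).
Proof.
move=> [oA cA]; split; first exact: open_preim_s.
by move: A cA {oA}; apply/continuous_closedP; exact: s_continuous.
Qed.

Lemma unit_space_hausdorff : hausdorff_space G0.
Proof.
rewrite open_hausdorff => x y xy.
have uxy : u x != u y.
  by apply: contra_neq xy => /(congr1 r); rewrite !(gpd_r_unit gG).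
have := etale_hausdorff etG; rewrite open_hausdorff => /(_ _ _ uxy).
move=> [[A B] /= [Ax By] [oA oB /eqP AB]].
have ou := (continuousP u).1 (etale_u_cont etG).
exists (u @^-1` A, u @^-1` B) => /=; first by move: Ax By; rewrite !inE.
split; [exact: ou|exact: ou|].
by rewrite -preimage_setI AB preimage_set0.
Qed.

Lemma Gset_sub W W' : W `<=` W' -> Gset r s W' -> Gset r s W.
Proof.
move=> WW' [ir is_]; split=> g h; rewrite !inE => Wg Wh; [apply: ir|apply: is_];
  by rewrite inE; exact: WW'.
Qed.

Lemma Gset_inv W : Gset r s W -> Gset r s (inv @` W).
Proof.
have inj_inv : injective inv by exact: inv_inj invK.
move=> [ir is_]; split=> _ _ /set_mem[g Wg <-] /set_mem[h Wh <-].
  by rewrite !(gpd_r_inv gG) => E; congr inv; apply: is_ => //; exact/mem_set.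
by rewrite !(gpd_s_inv gG) => E; congr inv; apply: ir => //; exact/mem_set.
Qed.

Lemma Gset_r_inj W g h : Gset r s W -> W g -> W h -> r g = r h -> g = h.
Proof. by move=> [ir _] Wg Wh; apply: ir; rewrite inE. Qed.

Lemma Gset_s_inj W g h : Gset r s W -> W g -> W h -> s g = s h -> g = h.
Proof. by move=> [_ is_] Wg Wh; apply: is_; rewrite inE. Qed.

Lemma Gset_nbhs g : exists W, [/\ open W, W g & Gset r s W].
Proof.
have [_ lr] := etale_r_local_homeo etG.
have [W [oW Wg _ iW _]] := lr g; have [V [oV Vg _ iV _]] := lr (inv g).
exists (W `&` inv @` V); split.
- by apply: openI => //; exact: inv_open.
- by split=> //; rewrite inv_image.
split=> h k /set_mem[Wh]; rewrite inv_image => Vh /set_mem[Wk Vk] E.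
  by apply: iW => //; exact/mem_set.
rewrite -[h]invK -[k]invK; congr inv; apply: iV; [exact/mem_set|exact/mem_set|].
by rewrite !(gpd_r_inv gG).
Qed.

(** On an open [G]-set the map [r] is open and injective, so a cluster point in [D] of the image
    filter lifts to a cluster point upstairs. *)
Lemma compact_Gset_preim W D : open W -> Gset r s W -> compact D ->
  D `<=` r @` W -> compact (W `&` r @^-1` D).
Proof.
move=> oW GW cD DW F FF FWD.
have FrD : F (r @^-1` D) by apply: filterS FWD => g [].
have [x [Dx clx]] := cD (r @ F) _ FrD.
have [g Wg gx] := DW x Dx; exists g; split; first by split=> //=; rewrite gx.
move=> A N FA; rewrite nbhsE => -[N' [oN' N'g] N'N].
have FrA : F (r @^-1` (r @` (A `&` W))).
  by apply: filterS (filterI FA FWD) => h [Ah [Wh _]]; exists h.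
have nx : nbhs x (r @` (N' `&` W)).
  apply: open_nbhs_nbhs; split; first by apply: r_open; exact: openI.
  by exists g.
have [_ [[h [Ah Wh] <-] [k [Nk Wk] rhk]]] := clx _ _ FrA nx.
by exists h; split=> //; apply: N'N; rewrite -(Gset_r_inj GW Wk Wh rhk).
Qed.

Context (cG0 : compact [set: G0]) (tG0 : totally_disconnected [set: G0]).

Lemma clopen_compact A : clopen A -> compact A.
Proof. by move=> [_ cA]; exact: (subclosed_compact cA cG0). Qed.

Lemma clopen_nbhs N x : open N -> N x -> exists D, [/\ clopen D, D x & D `<=` N].
Proof. exact: totally_disconnected_clopen_nbhs unit_space_hausdorff cG0 tG0. Qed.

(** An open [G]-set around [g] inside [O] is cut down to the part lying over a small clopen
    neighbourhood of [r g], which makes it compact. *)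
Lemma bisection_nbhs O g : open O -> O g ->
  exists W, [/\ bisection r s W, W g & W `<=` O].
Proof.
move=> oO Og; have [W [oW Wg GW]] := Gset_nbhs g.
have oOW : open (O `&` W) by exact: openI.
have GOW : Gset r s (O `&` W) by apply: Gset_sub GW; exact: subIsetr.
have [|D [cD Dg DOW]] := clopen_nbhs (r_open oOW) (x := r g); first by exists g.
exists (O `&` W `&` r @^-1` D); split=> //; last by move=> h [[]].
split; last by apply: Gset_sub GOW; exact: subIsetl.
  by apply: compact_Gset_preim => //; exact: clopen_compact.
by apply: openI => //; apply: open_preim_r; case: cD.
Qed.

(** This is why bisections are taken compact: their ranges and sources are clopen, so what a
    matching leaves over is clopen again. *)
Lemma compact_image_clopen (f : G -> G0) W : continuous f ->
  (forall O, open O -> open (f @` O)) -> compact W -> open W -> clopen (f @` W).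
Proof.
move=> cf of_ cW oW; split; first exact: of_.
apply: compact_closed; first exact: unit_space_hausdorff.
by apply: continuous_compact => //; exact: continuous_subspaceT.
Qed.

Lemma bisection_clopen_r W : bisection r s W -> clopen (r @` W).
Proof.
by move=> [? ? _]; apply: compact_image_clopen => //; [exact: r_continuous|exact: r_open].
Qed.

Lemma bisection_clopen_s W : bisection r s W -> clopen (s @` W).
Proof.
by move=> [? ? _]; apply: compact_image_clopen => //; [exact: s_continuous|exact: s_open].
Qed.

Lemma bisection0 : bisection r s set0.
Proof.
split; [exact: compact0|exact: open0|].
by split=> g h; rewrite inE.
Qed.

Lemma bisection_clopenI W O : bisection r s W -> clopen O -> bisection r s (W `&` O).
Proof.
move=> [cW oW GW] [oO cO]; split.
- exact: compact_closedI.
- exact: openI.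
- by apply: Gset_sub GW; exact: subIsetl.
Qed.

Lemma compact_inv C : compact C -> compact (inv @` C).
Proof.
move=> cC; apply: continuous_compact cC; apply: continuous_subspaceT.
exact: etale_inv_cont etG.
Qed.

Lemma bisection_inv W : bisection r s W -> bisection r s (inv @` W).
Proof. by move=> [? ? ?]; split; [exact: compact_inv|exact: inv_open|exact: Gset_inv]. Qed.

Lemma GsetU W W' : Gset r s W -> Gset r s W' ->
  r @` W `&` r @` W' = set0 -> s @` W `&` s @` W' = set0 ->
  Gset r s (W `|` W').
Proof.
have aux (f : G -> G0) (A B : set G) : set_inj A f -> set_inj B f ->
    f @` A `&` f @` B = set0 -> set_inj (A `|` B) f.
  move=> iA iB AB g h /set_mem[Ag|Bg] /set_mem[Ah|Bh] E.
  - by apply: iA => //; exact/mem_set.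
  - by have : (f @` A `&` f @` B) (f g) by [split; [exists g|exists h]]; rewrite AB.
  - by have : (f @` A `&` f @` B) (f g) by [split; [exists h|exists g]]; rewrite AB.
  - by apply: iB => //; exact/mem_set.
by move=> [? ?] [? ?] ? ?; split; exact: aux.
Qed.

Lemma bisectionU W W' : bisection r s W -> bisection r s W' ->
  r @` W `&` r @` W' = set0 -> s @` W `&` s @` W' = set0 ->
  bisection r s (W `|` W').
Proof.
move=> [? ? ?] [? ? ?] ? ?.
by split; [exact: compactU|exact: openU|exact: GsetU].
Qed.

(** An open [G]-set contains at most one arrow with a given source, and finitely many such sets
    cover [C]. *)
Lemma finite_fiber C x : compact C -> finite_set [set g | C g /\ s g = x].
Proof.
move=> cC; apply: (@compact_ind _ C (fun C => finite_set [set g | C g /\ s g = x]) cC).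
- by rewrite (_ : [set _ | _] = set0)// -subset0 => g [].
- by move=> A B AB; apply: sub_finite_set => g [/AB].
- move=> A B fA fB.
  rewrite (_ : [set _ | _] = [set g | A g /\ s g = x] `|` [set g | B g /\ s g = x]).
    by rewrite finite_setU.
  by apply/seteqP; split=> g /=; tauto.
- move=> g _; have [W [oW Wg GW]] := Gset_nbhs g; exists W; split=> //.
  have [[h [Wh hx]]|nh] := pselect (exists h, W h /\ s h = x).
    apply: (@sub_finite_set _ _ [set h]); last exact: finite_set1.
    by move=> k [Wk kx]; apply: (Gset_s_inj GW) => //; rewrite kx.
  rewrite (_ : [set _ | _] = set0)// -subset0 => h Wh.
  by apply: nh; exists h.
Qed.

(* Compactness of [C] lets local bisections be treated one after the other, each
   matching only what the previous ones left over. *)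
Lemma greedy_matching C O U V : compact C -> open O -> C `<=` O ->
  clopen U -> clopen V -> exists W,
  [/\ bisection r s W, W `<=` O, r @` W `<=` U, s @` W `<=` V &
      forall g, C g -> U (r g) -> V (s g) -> (r @` W) (r g) \/ (s @` W) (s g)].
Proof.
(* [U] and [V] are quantified inside [P], since the second half of a union is matched between the
   remainders of the first. *)
move=> cC oO CO; pose P (C : set G) := forall U V : set G0, clopen U -> clopen V ->
  exists W : set G, [/\ bisection r s W, W `<=` O, r @` W `<=` U, s @` W `<=` V &
      forall g, C g -> U (r g) -> V (s g) -> (r @` W) (r g) \/ (s @` W) (s g)].
move: U V; change (P C); apply: compact_ind => //.
- move=> U V _ _; exists set0; split=> //; first exact: bisection0.
    by rewrite image_set0.
  by rewrite image_set0.
- move=> A B AB PB U V cU cV; have [W [bW WO WU WV WB]] := PB U V cU cV.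
  by exists W; split=> // g /AB; exact: WB.
- move=> A B PA PB U V cU cV; have [W [bW WO WU WV WA]] := PA U V cU cV.
  have cU' := clopenD cU (bisection_clopen_r bW).
  have cV' := clopenD cV (bisection_clopen_s bW).
  have [W' [bW' WO' WU' WV' WB]] := PB _ _ cU' cV'.
  exists (W `|` W'); rewrite !image_setU; split.
  + apply: bisectionU => //; rewrite -subset0 => x [Wx].
      by move=> /WU'[].
    by move=> /WV'[].
  + by rewrite subUset.
  + by rewrite subUset; split=> // x /WU'[].
  + by rewrite subUset; split=> // x /WV'[].
  + move=> g [Ag|Bg] Ug Vg; first by case: (WA g Ag Ug Vg) => ?; [left|right]; left.
    have [Wr|nWr] := pselect ((r @` W) (r g)); first by left; left.
    have [Ws|nWs] := pselect ((s @` W) (s g)); first by right; left.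
    by case: (WB g Bg (conj Ug nWr) (conj Vg nWs)) => ?; [left|right]; right.
- move=> g Cg; have [W [bW Wg WO]] := bisection_nbhs oO (CO g Cg).
  exists W; split=> //; first by case: bW.
  move=> U V cU cV; exists (W `&` (r @^-1` U `&` s @^-1` V)); split.
  + apply: bisection_clopenI => //; apply: clopenI; first exact: clopen_preim_r.
    exact: clopen_preim_s.
  + by move=> h [/WO].
  + by move=> _ [h [_ [? _]] <-].
  + by move=> _ [h [_ [_ ?]] <-].
  + by move=> h Wh Uh Vh; left; exists h.
Qed.

End EtaleGroupoid.

(** * From finitely additive functions on clopen sets to Borel probabilities *)

Definition clopen_type (T : Type) : Type := T.
Definition clopen_display : Type -> measure_display. Proof. exact. Qed.

HB.instance Definition _ (T : ptopologicalType) := Pointed.on (clopen_type T).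
HB.instance Definition _ (T : ptopologicalType) :=
  @isRingOfSets.Build (clopen_display T) (clopen_type T) (@clopen T)
    (@clopen0 T) (@clopenU T) (@clopenD T).

Section ClopenMeasure.
Context {R : realType} {T : ptopologicalType}.
Context (cT : compact [set: T]).
Context {lam : set T -> R} (lam_ge0 : forall A, 0 <= lam A).
Context (lamU : forall A B, A `&` B = set0 -> lam (A `|` B) = lam A + lam B).

Let lam0 : lam set0 = 0.
Proof.
have := lamU (set0I set0); rewrite setU0 => /eqP.
by rewrite -subr_eq subrr => /eqP.
Qed.

Definition clopen_content (A : set (clopen_type T)) : \bar R := (lam A)%:E.

Let content0 : clopen_content set0 = 0%E.
Proof. by rewrite /clopen_content lam0. Qed.

Let content_ge0 A : (0 <= clopen_content A)%E.
Proof. by rewrite lee_fin. Qed.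

Let content_sigma_additive : semi_sigma_additive clopen_content.
Proof.
move=> F mF tF mUF.
(* The union is clopen, hence compact, so finitely many of the [F i] cover it and countable
   additivity reduces to finite additivity. *)
have [N FN] : exists N, \bigcup_n F n `<=` \bigcup_(i < N) F i.
  have [_ clU] : clopen (\bigcup_n F n : set T) := mUF.
  pose P (A : set T) := exists N, A `<=` \bigcup_(i < N) F i.
  apply: (@compact_ind _ _ P (subclosed_compact clU cT _)) => //.
  - by exists 0%N.
  - by move=> A B AB [N BN]; exists N; exact: subset_trans BN.
  - move=> A B [N AN] [M BM]; exists (maxn N M) => x [/AN|/BM] [i /= iN Fi].
      by exists i => //=; rewrite leq_max iN.
    by exists i => //=; rewrite leq_max iN orbT.
  - move=> x [i _ Fi]; exists (F i); split=> //; first by have [] := mF i.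
    by exists i.+1 => y Fy; exists i => /=.
have sumE n : (\sum_(0 <= i < n) clopen_content (F i) =
               (lam (\bigcup_(i < n) F i))%:E)%E.
  rewrite bigcup_mkord big_mkord; elim: n => [|n ih].
    by rewrite !big_ord0 lam0.
  rewrite !big_ord_recr/= ih lamU// -subset0 => x.
  by rewrite -bigcup_mkord => -[[i /= ni Fi] Fn]; have := tF i n I I;
    move/(_ (ex_intro _ x (conj Fi Fn))) => ni'; rewrite ni' ltnn in ni.
apply: cvg_near_cst; exists N => // n /= Nn; rewrite sumE; congr (lam _)%:E.
apply/seteqP; split=> [x [i _ Fi]|x /FN[i /= iN Fi]]; first by exists i.
by exists i => //=; exact: leq_trans Nn.
Qed.

HB.instance Definition _ := isMeasure.Build _ _ _ clopen_content
  content0 content_ge0 content_sigma_additive.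

Context (lamT : lam setT = 1).
Context (open_clopens : forall O : set T, open O ->
  exists F : nat -> set T, (forall n, clopen (F n)) /\ O = \bigcup_n F n).

Let Cl := g_sigma_algebraType (@measurable _ (clopen_type T)).

(** The Carathéodory extension lives on the sigma-algebra [Cl] generated by the clopen sets; since
    open sets are countable unions of clopen ones, it can be read on Borel sets. *)
Let borel_measurable (A : set T) : (@measurable _ (Borel T)) A -> (@measurable _ Cl) A.
Proof.
apply: smallest_sub; first exact: sigma_algebra_measurable.
move=> N oN; have [F [cF ->]] := open_clopens oN.
by apply: (@bigcupT_measurable _ Cl) => n; apply: sub_sigma_algebra; exact: cF.
Qed.

Definition clopen_measure (A : set (Borel T)) : \bar R :=
  measure_extension clopen_content A.

Lemma clopen_measureE A : clopen A -> clopen_measure A = (lam A)%:E.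
Proof. by move=> cA; exact: (@measurable_mu_extE _ R (clopen_type T)). Qed.

Let measure0 : clopen_measure set0 = 0%E.
Proof. exact: (@measure0 _ Cl). Qed.

Let measure_ge0 A : (0 <= clopen_measure A)%E.
Proof. exact: (@measure_ge0 _ Cl). Qed.

Let measure_sigma_additive : semi_sigma_additive clopen_measure.
Proof.
move=> F mF tF mUF; apply: (@measure_semi_sigma_additive _ Cl) => //.
- by move=> i; exact: borel_measurable.
- exact: borel_measurable.
Qed.

HB.instance Definition _ := isMeasure.Build _ _ _ clopen_measure
  measure0 measure_ge0 measure_sigma_additive.

Let measureT : clopen_measure setT = 1%E.
Proof. by rewrite clopen_measureE ?lamT//; exact: clopenT. Qed.

HB.instance Definition _ := Measure_isProbability.Build _ _ _ clopen_measure measureT.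

Lemma clopen_measure_exists : exists mu : probability (Borel T) R,
  forall A, clopen A -> mu A = (lam A)%:E.
Proof. by exists clopen_measure => A; exact: clopen_measureE. Qed.

End ClopenMeasure.

(** * Countable families of bisections and frequencies along orbits *)

Lemma countable_enum (T : choiceType) (A : set T) (x0 : T) : countable A ->
  exists e : nat -> T, forall a, A a -> exists n, e n = a.
Proof.
move=> /countable_injP[f injf].
(* The default [x0] fills the indices that code no element of [A], which also covers an empty
   [A]. *)
have /choice[e eP] : forall n, exists x, forall a, A a -> f a = n -> x = a.
  move=> n; have [[a [Aa fan]]|nA] := pselect (exists a, A a /\ f a = n).
    exists a => b Ab fbn; apply: injf; rewrite ?inE//.
    by rewrite fan fbn.
  by exists x0 => a Aa fan; exfalso; apply: nA; exists a.
by exists e => a Aa; exists (f a); exact: eP.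
Qed.

(** An ultrafilter contains the preimage of [N] or its complement, and clustering at [l] excludes
    the complement. *)
Lemma ultra_cluster_cvg {I : Type} {T : topologicalType} (U : set_system I)
  (f : I -> T) (l : T) : UltraFilter U -> cluster (f @ U) l -> f @ U --> l.
Proof.
move=> ultraU cl N Nl; have [//|UN] := in_ultra_setVsetC (f @^-1` N) ultraU.
by have [y []] := cl (~` N) N UN Nl.
Qed.

Section EtaleGroupoidMeasures.
Context {R : realType} {G : topologicalType} {G0 : ptopologicalType}.
Context {r s : G -> G0} {u : G0 -> G} {mul : G -> G -> G} {inv : G -> G}.
Context (etG : is_etale_groupoid r s u mul inv) (scG : @second_countable G).
Context (cG0 : compact [set: G0]) (tG0 : totally_disconnected [set: G0]).
Implicit Types (W C K O : set G) (A B D U V N : set G0) (g h k : G) (x y : G0).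

Let gG : is_groupoid r s u mul inv := etale_groupoid etG.

(** Basic open sets need not be bisections. For each of them one bisection between it and [O] is
    chosen if there is any, and [set0] otherwise; every [g] in [O] has a basic neighbourhood for
    which there is one. *)
Lemma open_bisections O : open O -> exists B : nat -> set G,
  (forall n, bisection r s (B n)) /\ O = \bigcup_n B n.
Proof.
move=> oO; have [b /(@countable_enum _ _ set0)[e eP] [ob bP]] := scG.
have /choice[B BP] n : exists c, [/\ bisection r s c, c `<=` O &
    forall c', bisection r s c' -> e n `<=` c' -> c' `<=` O -> e n `<=` c].
  have [[c [bc ec cO]]|nc] := pselect (exists c, [/\ bisection r s c, e n `<=` c & c `<=` O]).
    by exists c; split.
  exists set0; split=> //; first exact: bisection0.
  by move=> c bc ec cO; exfalso; apply: nc; exists c.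
exists B; split; first by move=> n; have [] := BP n.
apply/seteqP; split=> [g Og|g [n _]]; last by have [_ + _] := BP n; exact.
have [W [bW Wg WO]] := bisection_nbhs etG cG0 tG0 oO Og.
have [_ oW _] := bW.
have [a [ba ag] aW] := bP g W (open_nbhs_nbhs (conj oW Wg)).
have [n en] := eP a ba; exists n => //.
have [_ _ /(_ W bW)] := BP n; rewrite en; exact.
Qed.

Lemma unit_space_second_countable : @second_countable G0.
Proof.
have [b cb [ob bP]] := scG; exists ((fun c => r @` c) @` b).
  exact: card_le_trans (card_image_le _ _) cb.
split=> [_ [c bc <-]|x N Nx]; first by apply: (r_open etG); exact: ob.
have : nbhs (u x) (r @^-1` N).
  by apply: (r_continuous etG); rewrite (gpd_r_unit gG).
move=> /bP[c [bc cx] cN]; exists (r @` c).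
  split; first by exists c.
  by exists (u x) => //; rewrite (gpd_r_unit gG).
by move=> _ [g /cN ? <-].
Qed.

Lemma clopen_enum : exists e : nat -> set G0, (forall n, clopen (e n)) /\
  forall A, clopen A -> exists n, e n = A.
Proof.
have /(@countable_enum _ _ set0)[e eP] := clopen_countable cG0 unit_space_second_countable.
exists (fun n => if pselect (clopen (e n)) then e n else set0).
split=> [n|A cA]; first by case: pselect => // ?; exact: clopen0.
by have [n en] := eP A cA; exists n; case: pselect => //; rewrite en.
Qed.

Lemma open_bigcup_clopen N : open N ->
  exists F : nat -> set G0, (forall n, clopen (F n)) /\ N = \bigcup_n F n.
Proof.
move=> oN; have [e [ce eP]] := clopen_enum.
exists (fun n => if pselect (e n `<=` N) then e n else set0); split=> [n|].
  by case: pselect => ?; [exact: ce|exact: clopen0].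
apply/seteqP; split=> [x Nx|x [n _]]; last by case: pselect => // /[apply].
have [D [cD Dx DN]] := clopen_nbhs etG cG0 tG0 oN Nx.
by have [n en] := eP D cD; exists n => //; case: pselect => //; rewrite en.
Qed.

Lemma clopen_nbhs_seq x : exists N : nat -> set G0,
  (forall n, clopen (N n) /\ N n x) /\
  forall O : set G0, open O -> O x -> exists n, N n `<=` O.
Proof.
have [e [ce eP]] := clopen_enum.
(* Clopen sets missing [x] are replaced by the whole space; the sequence need not decrease. *)
exists (fun n => if pselect (e n x) then e n else setT); split=> [n|O oO Ox].
  by case: pselect => ?; split=> //; [exact: ce|exact: clopenT].
have [D [cD Dx DN]] := clopen_nbhs etG cG0 tG0 oO Ox.
by have [n en] := eP D cD; exists n; case: pselect; rewrite en.
Qed.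

Lemma finite_Korbit K x : compact K -> finite_set (Korbit r s K x).
Proof. by move=> cK; apply: finite_image; exact: finite_fiber etG _ _ cK. Qed.

Lemma Korbit_unit K x : (forall x, K (u x)) -> Korbit r s K x x.
Proof.
by move=> Ku; exists (u x); rewrite ?(gpd_r_unit gG)//; split; rewrite ?(gpd_s_unit gG).
Qed.

Lemma finite_Kprod C K x : compact C -> compact K -> finite_set (Kprod r s mul C K x).
Proof.
move=> cC cK.
apply: (@sub_finite_set _ _ (\bigcup_(k in Kfib s K x)
  ((fun c => mul c k) @` [set c | C c /\ s c = r k]))).
  by move=> _ [c [k [Cc Kk ck ->]]]; exists k => //; exists c.
apply: bigcup_finite; first exact: finite_fiber etG _ _ cK.
by move=> k _; apply: finite_image; exact: finite_fiber etG _ _ cC.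
Qed.

(* An arrow [w] of [W] moves a point [r k] of the orbit inside the orbit unless
   [mul w k] leaves [K]. *)
Lemma scard_source_le W C K x : Gset r s W -> W `<=` C -> compact C ->
  elementary_subgroupoid r s u mul inv K ->
  (scard (s @` W `&` Korbit r s K x) <= scard (r @` W `&` Korbit r s K x) +
     scard (Kprod r s mul C K x `\` Kfib s K x))%N.
Proof.
move=> GW WC cC [[cK oK Ku KM KV] _].
have fK : finite_set (Korbit r s K x) by exact: finite_Korbit.
set S := s @` W `&` _.
have /choice[f fP] y : exists g, S y -> exists w k,
    [/\ W w, s w = y, Kfib s K x k, r k = y & g = mul w k].
  have [Sy|nSy] := pselect (S y); last by exists (u y).
  have [[w Ww wy] [k Kk ky]] := Sy.
  by exists (mul w k) => _; exists w, k.
have rf y w k : s w = y -> r k = y -> f y = mul w k -> r (f y) = r w.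
  by move=> wy ky ->; rewrite (gpd_r_mul gG)// wy.
have injrf : {in S &, injective (r \o f)}.
  move=> y y' /set_mem/fP[w [k [Ww wy Kk ky fy]]] /set_mem/fP[w' [k' [Ww' wy' Kk' ky' fy']]].
  rewrite /= (rf _ _ _ wy ky fy) (rf _ _ _ wy' ky' fy') => E.
  by rewrite -wy -wy' (Gset_r_inj GW Ww Ww' E).
have injf : {in S &, injective f}.
  by move=> y y' Sy Sy' E; apply: injrf => //=; rewrite E.
have fS : finite_set S by apply: finite_setIr.
(* Points of [S1], whose product stays in [K], inject into the range side by [r \o f]; points of
   [S2] inject by [f] into the products that leave [K]. *)
pose S1 := S `&` f @^-1` Kfib s K x; pose S2 := S `&` ~` (f @^-1` Kfib s K x).
have -> : S = S1 `|` S2 by rewrite -setIUr setUv setIT.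
have fS1 : finite_set S1 by apply: finite_setIl.
have fS2 : finite_set S2 by apply: finite_setIl.
apply: leq_trans (scardU_le fS1 fS2) _; apply: leq_add.
  apply: (@scard_inj _ _ _ _ (r \o f)) => //.
  - exact: finite_setIr.
  - by move=> y y' /set_mem[Sy _] /set_mem[Sy' _]; apply: injrf; exact/mem_set.
  - move=> _ [y [Sy Ky] <-]; have [w [k [Ww wy Kk ky fy]]] := fP y Sy.
    split; last by exists (f y).
    by exists w => //; rewrite /= (rf _ _ _ wy ky fy).
apply: (@scard_inj _ _ _ _ f) => //.
- exact/finite_setD/finite_Kprod.
- by move=> y y' /set_mem[Sy _] /set_mem[Sy' _]; apply: injf; exact/mem_set.
- move=> _ [y [Sy Ky] <-]; split=> //; have [w [k [Ww wy Kk ky fy]]] := fP y Sy.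
  by exists w, k; split=> //; [exact: WC|rewrite wy].
Qed.

(** For compact [K] containing the units this is the uniform probability measure on the finite orbit
    [K(x)]. *)
Definition orbit_freq K x A : R :=
  (scard (A `&` Korbit r s K x))%:R / (scard (Korbit r s K x))%:R.

Lemma orbit_freq_ge0 K x A : 0 <= orbit_freq K x A.
Proof. by rewrite divr_ge0. Qed.

Lemma le_orbit_freq K x A B :
  (scard (A `&` Korbit r s K x) <= scard (B `&` Korbit r s K x))%N ->
  orbit_freq K x A <= orbit_freq K x B.
Proof. by move=> AB; rewrite ler_wpM2r ?invr_ge0// ler_nat. Qed.

Lemma orbit_freq_le1 K x A : compact K -> orbit_freq K x A <= 1.
Proof.
move=> cK; have fK := finite_Korbit x cK; rewrite /orbit_freq.
have [->|n0] := eqVneq (scard (Korbit r s K x)) 0%N; first by rewrite invr0 mulr0.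
by rewrite ler_pdivrMr ?ltr0n ?lt0n// mul1r ler_nat le_scard.
Qed.

Lemma orbit_freqU K x A B : compact K -> A `&` B = set0 ->
  orbit_freq K x (A `|` B) = orbit_freq K x A + orbit_freq K x B.
Proof.
move=> cK AB; have fK := finite_Korbit x cK; rewrite /orbit_freq -mulrDl -natrD.
rewrite setIUl scardU//; [exact: finite_setIr|exact: finite_setIr|].
by rewrite setIACA AB set0I.
Qed.

Lemma orbit_freqT K x : compact K -> (forall x, K (u x)) -> orbit_freq K x setT = 1.
Proof.
move=> cK Ku; have fK := finite_Korbit x cK; rewrite /orbit_freq setTI divff//.
by rewrite pnatr_eq0 -lt0n; exact: scard_gt0 (Korbit_unit x Ku).
Qed.

(** The ratio bounded in almost finiteness; it controls how far the uniform measure on [K(x)] is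
    from being invariant under [G]-sets inside [C]. *)
Definition defect C K x : R :=
  (scard (Kprod r s mul C K x `\` Kfib s K x))%:R / (scard (Korbit r s K x))%:R.

Lemma orbit_freq_source_le W C K x : Gset r s W -> W `<=` C -> compact C ->
  elementary_subgroupoid r s u mul inv K ->
  orbit_freq K x (s @` W) <= orbit_freq K x (r @` W) + defect C K x.
Proof.
move=> GW WC cC eK; rewrite /orbit_freq /defect -mulrDl -natrD.
by rewrite ler_wpM2r ?invr_ge0// ler_nat scard_source_le.
Qed.

End EtaleGroupoidMeasures.
Arguments orbit_freq {R G G0} r s K x A.
Arguments defect {R G G0} r s mul C K x.

(** * Invariant measures as limits of orbit frequencies *)

Lemma open_borel {T : ptopologicalType} (A : set T) : open A -> (@measurable _ (Borel T)) A.
Proof. by move=> oA; exact: sub_sigma_algebra. Qed.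

Lemma clopen_borel {T : ptopologicalType} (A : set T) : clopen A -> (@measurable _ (Borel T)) A.
Proof. by move=> [oA _]; exact: open_borel. Qed.

Lemma ler_cvg_filter {R : realType} {I : Type} (U : set_system I) (f g : I -> R)
  (l l' : R) : ProperFilter U -> f @ U --> l -> g @ U --> l' ->
  U [set p | f p <= g p] -> l <= l'.
Proof.
move=> PU fl gl fg; rewrite -subr_ge0.
apply: (@closed_cvg _ _ U PU (g - f) [set x : R | 0 <= x]) => //.
- by apply: filterS fg => p /=; rewrite subr_ge0.
- exact: cvgB.
Qed.

Section LimitMeasure.
Context {R : realType} {G : topologicalType} {G0 : ptopologicalType}.
Context {r s : G -> G0} {u : G0 -> G} {mul : G -> G -> G} {inv : G -> G}.
Context (etG : is_etale_groupoid r s u mul inv) (scG : @second_countable G).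
Context (cG0 : compact [set: G0]) (tG0 : totally_disconnected [set: G0]).
Implicit Types (W C K O : set G) (A B D U V N : set G0) (g h k : G) (x y : G0).

Lemma open_compact_union O : open O -> exists F : nat -> set G,
  [/\ forall n, compact (F n) /\ open (F n), nondecreasing_seq F & O = \bigcup_n F n].
Proof.
move=> oO; have [B [bB ->]] := open_bisections etG scG cG0 tG0 oO.
exists (fun n => \big[setU/set0]_(i < n) B i); split.
- move=> n; split.
    elim: n => [|n ih]; first by rewrite big_ord0; exact: compact0.
    by rewrite big_ord_recr; apply: compactU => //; have [] := bB n.
  elim: n => [|n ih]; first by rewrite big_ord0; exact: open0.
  by rewrite big_ord_recr; apply: openU => //; have [] := bB n.
- apply/nondecreasing_seqP => n; rewrite big_ord_recr/= subsetEset.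
  exact: subsetUl.
- apply/seteqP; split=> g [n _].
    by move=> Bg; exists n.+1 => //; rewrite big_ord_recr; right.
  by rewrite -bigcup_mkord => -[i _ Bi]; exists i.
Qed.

(** An open [G]-set is an increasing union of bisections, and measures are continuous from below. *)
Lemma invariant_of_bisections (mu : probability (Borel G0) R) :
  (forall W, bisection r s W -> mu (r @` W) = mu (s @` W)) -> invariant_measure r s mu.
Proof.
move=> muW W oW GW; have [F [cF ndF WF]] := open_compact_union oW.
have bF n : bisection r s (F n).
  have [? ?] := cF n; split=> //; apply: Gset_sub GW.
  by rewrite WF; exact: bigcup_sup.
have cvg_image (f : G -> G0) : (forall O, open O -> open (f @` O)) ->
    (fun n => mu (f @` F n)) @ \oo --> mu (f @` W).
  move=> of_; rewrite WF image_bigcup.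
  have mfF n : (@measurable _ (Borel G0)) (f @` F n).
    by apply: open_borel; apply: of_; have [] := cF n.
  apply: (@nondecreasing_cvg_mu _ (Borel G0) R mu (fun n => f @` F n)).
  - exact: mfF.
  - exact: bigcupT_measurable.
  - move=> m n mn; rewrite subsetEset; apply: image_subset.
    by rewrite -subsetEset; exact: ndF.
have cr := cvg_image r (r_open etG); have := cvg_image s (s_open etG).
rewrite -(_ : (fun n => mu (r @` F n)) = (fun n => mu (s @` F n))); last first.
  by apply/funext => n; exact: muW.
by move=> cs; exact: (cvg_unique _ cr cs).
Qed.

Context (Bad : set G -> G0 -> Prop).
Context (BadP : forall C (eps : R), compact C -> 0 < eps -> exists K x,
  [/\ elementary_subgroupoid r s u mul inv K, defect r s mul C K x < eps & Bad K x]).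

(** Frequencies on the chosen bad orbits converge along an ultrafilter that makes [C] large and
    [eps] small. The limit is finitely additive, hence extends to a Borel probability. Vanishing
    defect gives invariance, and a counting inequality valid on all bad orbits survives in the
    limit. *)
Lemma limit_measure : exists mu : probability (Borel G0) R,
  invariant_measure r s mu /\
  forall A B, clopen A -> clopen B ->
    (forall K x, Bad K x ->
      (scard (A `&` Korbit r s K x) <= scard (B `&` Korbit r s K x))%N) ->
    (mu A <= mu B)%E.
Proof.
pose I := (set G * R)%type.
pose D := [set p : I | compact p.1 /\ 0 < p.2].
pose up (p : I) := [set q : I | [/\ D q, p.1 `<=` q.1 & q.2 <= p.2]].
have /choice[c cP] (p : I) : exists q : set G * G0, D p ->
    [/\ elementary_subgroupoid r s u mul inv q.1,
        defect r s mul p.1 q.1 q.2 < p.2 & Bad q.1 q.2].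
  have [[cp p0]|nD] := pselect (D p); last by exists (set0, point).
  by have [K [x ?]] := BadP cp p0; exists (K, x).
(* The tails of the directed set of pairs [(C, eps)]; an ultrafilter finer than [F] gives limits for
   all sets [A] at once. *)
pose F := filter_from D up.
have FF : Filter F.
  apply: filter_from_filter; first by exists (set0, 1); split=> //; exact: compact0.
  move=> p q [cp p0] [cq q0]; exists (p.1 `|` q.1, Order.min p.2 q.2).
    by split=> /=; [exact: compactU|rewrite lt_min p0].
  move=> t [Dt /= ]; rewrite subUset le_min => -[? ?] /andP[? ?].
  by split; split.
have PF : ProperFilter F by apply: filter_from_proper => p Dp; exists p; split.
have [Ul [ultraU FU]] := ultraFilterLemma PF.
have upU p : D p -> Ul (up p) by move=> Dp; apply: FU; exists p.
pose D0 : I := (set0, 1).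
have DD0 : D D0 by split=> //; exact: compact0.
pose freq (A : set G0) (p : I) : R := orbit_freq r s (c p).1 (c p).2 A.
have /choice[lam lamP] A : exists l : R, freq A @ Ul --> l.
  (* Frequencies lie in the compact interval from 0 to 1, so they cluster, and along an ultrafilter
     they converge. *)
  have cseg : compact (`[0, 1]%classic : set R) by exact: segment_compact.
  have UA : Ul (freq A @^-1` `[0, 1]%classic).
    apply: filterS (upU _ DD0) => p [Dp _ _]; have [[[cK _ _ _ _] _] _ _] := cP p Dp.
    by rewrite /= in_itv /= orbit_freq_ge0 (orbit_freq_le1 etG).
  by have [l [_ cl]] := cseg (freq A @ Ul) _ UA; exists l; exact: ultra_cluster_cvg.
have nearD (P : I -> Prop) : (forall p, D p -> P p) -> \forall p \near Ul, P p.
  by move=> DP; apply: filterS (upU _ DD0) => p [/DP].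
have lam_ge0 A : 0 <= lam A.
  apply: (@ler_cvg_filter _ _ Ul (fun _ => 0) (freq A)) => //; first exact: cvg_cst.
  by apply: nearD => p _; exact: orbit_freq_ge0.
have lam_unique A l : freq A @ Ul --> l -> lam A = l.
  by move=> cl; apply: (cvg_unique _ (lamP A) cl); exact: Rhausdorff.
have lamU A B : A `&` B = set0 -> lam (A `|` B) = lam A + lam B.
  move=> AB; apply: lam_unique; apply: cvg_trans (cvgD (lamP A) (lamP B)).
  apply: near_eq_cvg; apply: nearD => p Dp; have [[[cK _ _ _ _] _] _ _] := cP p Dp.
  by rewrite /freq /= (orbit_freqU etG).
have lamT : lam setT = 1.
  apply: lam_unique; apply: cvg_near_cst; apply: nearD => p Dp.
  by have [[[cK _ Ku _ _] _] _ _] := cP p Dp; rewrite /freq (orbit_freqT etG).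
have [mu muE] := clopen_measure_exists cG0 lam_ge0 lamU lamT
  (open_bigcup_clopen etG scG cG0 tG0).
have lam_source_le W : bisection r s W -> lam (s @` W) <= lam (r @` W).
  move=> [cW oW GW]; apply/ler_addgt0Pr => e e0.
  apply: (@ler_cvg_filter _ _ Ul (freq (s @` W)) (fun p => freq (r @` W) p + e)) => //.
    by apply: cvgD => //; exact: cvg_cst.
  (* Beyond the pair [(W, e)] the counting bound applies to [W] with defect below [e]. *)
  have DWe : D (W, e) by [].
  apply: filterS (upU _ DWe) => p [Dp /= Wp pe]; have [eK dK _] := cP p Dp.
  apply: le_trans (orbit_freq_source_le etG (c p).2 GW Wp Dp.1 eK) _.
  rewrite lerD2l.
  exact: le_trans (ltW dK) pe.
exists mu; split.
  apply: invariant_of_bisections => W bW.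
  rewrite !muE; [|exact: bisection_clopen_s etG _ bW|exact: bisection_clopen_r etG _ bW].
  congr EFin; apply/eqP; rewrite eq_le lam_source_le// andbT.
  (* The inverse bisection exchanges range and source and so gives the reverse inequality. *)
  have := lam_source_le _ (bisection_inv etG bW).
  by rewrite (s_inv_image etG) (r_inv_image etG).
move=> A B cA cB AB; rewrite !muE// lee_fin.
apply: (@ler_cvg_filter _ _ Ul (freq A) (freq B)) => //.
by apply: nearD => p Dp; have [_ _ bad] := cP p Dp; exact/le_orbit_freq/AB.
Qed.

End LimitMeasure.

(** * Elements of the full group preserve invariant measures *)

Lemma open_neq {S T : topologicalType} (f g : S -> T) : hausdorff_space T ->
  continuous f -> continuous g -> open [set x | f x <> g x].
Proof.
move=> hT cf cg; rewrite openE => x /eqP fgx.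
move: hT; rewrite open_hausdorff => /(_ _ _ fgx)[[A B] /= [/set_mem Ax /set_mem Bx]].
move=> [oA oB /eqP AB].
have nA : nbhs x (f @^-1` A) by apply: cf; exact: open_nbhs_nbhs.
have nB : nbhs x (g @^-1` B) by apply: cg; exact: open_nbhs_nbhs.
apply: filterS (filterI nA nB) => y [/= Ay By] fgy.
by have : (A `&` B) (f y) by [split=> //; rewrite fgy]; rewrite AB.
Qed.

Section FullGroupInvariance.
Context {R : realType} {G : topologicalType} {G0 : ptopologicalType}.
Context {r s : G -> G0} {u : G0 -> G} {mul : G -> G -> G} {inv : G -> G}.
Context (etG : is_etale_groupoid r s u mul inv) (scG : @second_countable G).
Context (cG0 : compact [set: G0]) (tG0 : totally_disconnected [set: G0]).
Context (mu : probability (Borel G0) R) (imu : invariant_measure r s mu).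
Implicit Types (W : set G) (E U : set (Borel G0)).

(** For open [E] this is invariance applied to the open [G]-set of arrows in [W] with range in [E].
    The sets [E] that satisfy the claim form a Dynkin system, and open sets are stable under
    intersection. *)
Lemma invariant_Borel W E : open W -> Gset r s W -> measurable E ->
  measurable (s @` (W `&` r @^-1` E) : set (Borel G0)) /\
  mu (s @` (W `&` r @^-1` E)) = mu (E `&` r @` W).
Proof.
move=> oW GW.
have mr : measurable (r @` W : set (Borel G0)) by apply: open_borel; exact: (r_open etG).
have ms : measurable (s @` W : set (Borel G0)) by apply: open_borel; exact: (s_open etG).
pose phi (E : set G0) := s @` (W `&` r @^-1` E).
pose P (E : set G0) := (@measurable _ (Borel G0)) (phi E) /\ mu (phi E) = mu (E `&` r @` W).
move: E; change (forall E : set (Borel G0), <<s @open G0 >> E -> P E).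
have PO (N : set G0) : open N -> P N.
  move=> oN; have oWN : open (W `&` r @^-1` N).
    by apply: openI => //; exact: open_preim_r etG _ oN.
  split; first by apply: open_borel; exact: (s_open etG).
  rewrite -imu//; last by apply: Gset_sub GW; exact: subIsetl.
  congr (mu _); apply/seteqP; split=> [_ [g [Wg Ng] <-]|x [Nx [g Wg gx]]].
    by split=> //; exists g.
  by exists g => //; split=> //=; rewrite gx.
apply: dynkin_induction => //.
- exact: openI.
- by apply: PO; exact: openT.
- move=> E mE [mphi muphi].
  (* Injectivity of [s] on [W] turns complements into differences inside the source of [W]. *)
  have phiE : phi (~` E) = s @` W `\` phi E.
    apply/seteqP; split=> [_ [g [Wg nEg] <-]|_ [[g Wg <-] nphi]].
      split; first by exists g.
      move=> [h [Wh Eh] hg]; apply: nEg.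
      by rewrite /= -(Gset_s_inj GW Wh Wg hg).
    by exists g => //; split=> // Eg; apply: nphi; exists g.
  have phis : phi E `<=` s @` W by apply: image_subset; exact: subIsetl.
  split; first by rewrite phiE; exact: measurableD.
  rewrite phiE measureD//; last by rewrite ltey_eq fin_num_measure.
  rewrite (setIidr phis) [in RHS]setIC -setDE measureD//.
    by congr (_ - _)%E; [exact/esym/imu|rewrite setIC; exact: muphi].
  by rewrite ltey_eq fin_num_measure.
- move=> F mF tF PF.
  have phiU : phi (\bigcup_k F k) = \bigcup_k phi (F k).
    by rewrite /phi preimage_bigcup setI_bigcupr image_bigcup.
  have mphi n : measurable (phi (F n) : set (Borel G0)) by have [] := PF n.
  split; first by rewrite phiU; exact: bigcupT_measurable.
  rewrite phiU setI_bigcupl !measure_semi_bigcup//.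
  + by apply: eq_eseriesr => n _; have [] := PF n.
  + by move=> n; exact: measurableI.
  + by apply: trivIset_setIr.
  + by apply: bigcupT_measurable => n; exact: measurableI.
  + move=> i j _ _ [x [[g [Wg Fg] gx] [h [Wh Fh] hx]]].
    apply: tF => //; exists (r g); split=> //.
    by rewrite (@Gset_s_inj _ _ r s W g h)// gx hx.
  + exact: bigcupT_measurable.
Qed.

Lemma full_group_invariant gamma U : full_group r s gamma -> measurable U ->
  mu (gamma @` U) = mu U.
Proof.
move=> [[cg [gamma' [gK Kg cg']]] gfull] mU.
have [B [bB BT]] := open_bisections etG scG cG0 tG0 openT.
have oB n : open (B n) by have [] := bB n.
have GB n : Gset r s (B n) by have [] := bB n.
(* [E n] collects the points at which an arrow of [B n] realizes [gamma]. These sets cover the unit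
   space; made disjoint, they give pieces on which [gamma] acts through one bisection. *)
pose E n := r @` (B n `&` [set w | s w = gamma (r w)]).
have mE n : measurable (E n : set (Borel G0)).
  have oneq : open [set w | s w <> gamma (r w)].
    apply: open_neq (unit_space_hausdorff etG) (s_continuous etG) _ => w.
    by apply: continuous_comp; [exact: r_continuous etG w|exact: cg].
  (* Disagreement with [gamma] is an open condition on arrows, and [r] is injective on [B n], so
     [E n] is a difference of two open sets. *)
  have -> : E n = r @` B n `\` r @` (B n `&` [set w | s w <> gamma (r w)]).
    apply/seteqP; split=> [_ [w [Bw sw] <-]|_ [[w Bw <-] nw]].
      split; first by exists w.
      by move=> [w' [Bw' nw'] ww']; apply: nw'; rewrite (Gset_r_inj (GB n) Bw' Bw ww').
    exists w => //; split=> //; apply: contrapT => sw; apply: nw.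
    by exists w.
  apply: measurableD; first by apply: open_borel; exact: (r_open etG).
  by apply: open_borel; apply: (r_open etG); exact: openI.
pose F := seqDU (fun n => U `&` E n).
have FUE n : F n `<=` U `&` E n by exact: subset_seqDU.
have mF n : measurable (F n : set (Borel G0)).
  by apply: seqDU_measurable => i; exact: measurableI.
have UF : U = \bigcup_n F n.
  rewrite -seqDU_bigcup_eq -setI_bigcupr; apply/esym/setIidl => x Ux.
  have [g [gx sg]] := gfull x.
  have [n _ Bg] : (\bigcup_n B n) g by rewrite -BT.
  by exists n => //; exists g => //; split=> //=; rewrite gx.
have gF n : gamma @` F n = s @` (B n `&` r @^-1` (F n)).
  apply/seteqP; split=> [_ [x Fx <-]|_ [w [Bw Fw] <-]].
    have [_ [w [Bw sw] wx]] := FUE n x Fx.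
    by exists w; [split=> //=; rewrite wx|rewrite sw wx].
  exists (r w) => //; have [_ [w' [Bw' sw'] ww']] := FUE n _ Fw.
  by rewrite -ww' -sw' (Gset_r_inj (GB n) Bw' Bw ww').
have mugF n : measurable (gamma @` F n : set (Borel G0)) /\ mu (gamma @` F n) = mu (F n).
  rewrite gF; have [? ->] := invariant_Borel (oB n) (GB n) (mF n).
  split=> //; congr (mu _); apply: setIidl => x /FUE[_ [w [Bw _] wx]].
  by exists w.
have mgF n : measurable (gamma @` F n : set (Borel G0)) by have [] := mugF n.
have tF : trivIset setT F by exact: trivIset_seqDU.
rewrite UF image_bigcup !measure_semi_bigcup//.
- by apply: eq_eseriesr => n _; have [] := mugF n.
- exact: bigcupT_measurable.
- move=> i j _ _ [_ [[x Fx <-] [y Fy /(can_inj gK) yx]]].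
  by apply: tF => //; exists x; split=> //; rewrite -yx.
- exact: bigcupT_measurable.
Qed.

End FullGroupInvariance.

(** * Positivity of invariant measures and comparison of clopen sets *)

Definition invariant_content {R : realType} {G : topologicalType}
    {G0 : ptopologicalType} (r s : G -> G0) (m : set G0 -> R) :=
  exists mu : probability (Borel G0) R, invariant_measure r s mu /\
    forall A, clopen A -> mu A = (m A)%:E.

Section Comparison.
Context {R : realType} {G : topologicalType} {G0 : ptopologicalType}.
Context {r s : G -> G0} {u : G0 -> G} {mul : G -> G -> G} {inv : G -> G}.
Context (etG : is_etale_groupoid r s u mul inv) (scG : @second_countable G).
Context (cG0 : compact [set: G0]) (tG0 : totally_disconnected [set: G0]).
Context (afG : almost_finite r s u mul inv R) (minG : minimal_groupoid r s).
Implicit Types (W C K O : set G) (A B D U V N : set G0) (g h k : G) (x y : G0).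
Implicit Types m : set G0 -> R.

Let gG : is_groupoid r s u mul inv := etale_groupoid etG.
Local Notation icontent := (invariant_content r s).

(** Real-valued contents replace measures from here on, so that measures of clopen sets are handled
    by arithmetic in [R]; their values on other sets are unconstrained. *)
Lemma invariant_content_fine (mu : probability (Borel G0) R) :
  invariant_measure r s mu -> icontent (fun A => fine (mu A)).
Proof.
move=> imu; exists mu; split=> // A cA.
by rewrite fineK// fin_num_measure//; exact: clopen_borel.
Qed.

Lemma icontent_ge0 m A : icontent m -> clopen A -> 0 <= m A.
Proof. by move=> [mu [_ muE]] cA; rewrite -lee_fin -muE. Qed.

Lemma icontentT m : icontent m -> m setT = 1.
Proof.
move=> [mu [_ muE]]; apply: EFin_inj; rewrite -muE; last exact: clopenT.
exact: probability_setT.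
Qed.

Lemma icontentD m A B : icontent m -> clopen A -> clopen B -> B `<=` A ->
  m (A `\` B) = m A - m B.
Proof.
move=> [mu [_ muE]] cA cB BA; apply: EFin_inj; rewrite EFinB -!muE//; last exact: clopenD.
rewrite measureD//; [|exact: clopen_borel|exact: clopen_borel|].
  by rewrite (setIidr BA).
by rewrite ltey_eq fin_num_measure//; exact: clopen_borel.
Qed.

Lemma le_icontent m A B : icontent m -> clopen A -> clopen B -> B `<=` A -> m B <= m A.
Proof.
move=> im cA cB BA; rewrite -subr_ge0 -icontentD//.
by apply: icontent_ge0 => //; exact: clopenD.
Qed.

Lemma icontent0 m : icontent m -> m set0 = 0.
Proof.
move=> im; have c0 : clopen (@set0 G0) by exact: clopen0.
by have := icontentD im c0 c0 (@subset_refl _ _); rewrite set0D subrr.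
Qed.

Lemma icontentU_le m A B : icontent m -> clopen A -> clopen B ->
  m (A `|` B) <= m A + m B.
Proof.
move=> im cA cB; have cU := clopenU cA cB.
have := icontentD im cU cA (@subsetUl _ A B); rewrite setDUl setDv set0U => E.
have : m (B `\` A) <= m B by apply: le_icontent => //; exact: clopenD.
by rewrite E lerBlDl.
Qed.

Lemma icontent_bisection m W : icontent m -> bisection r s W ->
  m (r @` W) = m (s @` W).
Proof.
move=> [mu [imu muE]] bW; apply: EFin_inj; rewrite -!muE.
- by have [_ oW GW] := bW; exact: imu.
- exact: bisection_clopen_s etG _ bW.
- exact: bisection_clopen_r etG _ bW.
Qed.

Lemma minimal_arrow N x : open N -> N !=set0 -> exists g, s g = x /\ N (r g).
Proof.
move=> oN [y Ny]; have : closure (r @` (s @^-1` [set x])) y by rewrite minG.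
by move=> /(_ N (open_nbhs_nbhs (conj oN Ny)))[_ [[g gx <-] Ng]]; exists g.
Qed.

(** By minimality every point is the source of an arrow with range in [A]. If [A] were null, the
    source of a bisection around that arrow would be null too, and finitely many such sources would
    cover a space of mass 1. *)
Lemma icontent_gt0 m A : icontent m -> clopen A -> A !=set0 -> 0 < m A.
Proof.
move=> im cA A0; rewrite lt_neqAle icontent_ge0// andbT eq_sym; apply/eqP => mA0.
have [D [cD DT mD0]] : exists D, [/\ clopen D, [set: G0] `<=` D & m D = 0].
  apply: (@compact_ind _ _ (fun E => exists D, [/\ clopen D, E `<=` D & m D = 0]) cG0).
  - by exists set0; split=> //; [exact: clopen0|exact: icontent0].
  - by move=> E F EF [D [cD FD mD]]; exists D; split=> //; exact: subset_trans FD.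
  - move=> E F [D [cD ED mD]] [D' [cD' FD mD']]; exists (D `|` D'); split.
    + exact: clopenU.
    + exact: setUSS.
    + apply/eqP; rewrite eq_le icontent_ge0 ?andbT//; last exact: clopenU.
      by have := icontentU_le im cD cD'; rewrite mD mD' addr0.
  - move=> x _; have [g [gx Ag]] := minimal_arrow x cA.1 A0.
    have oA : open (r @^-1` A) by apply: (open_preim_r etG); exact: cA.1.
    have [W [bW Wg WA]] := bisection_nbhs etG cG0 tG0 oA Ag.
    have cr := bisection_clopen_r etG bW; have cs := bisection_clopen_s etG bW.
    exists (s @` W); split; [exact: cs.1|by exists g|].
    exists (s @` W); split=> //; apply/eqP; rewrite eq_le icontent_ge0// andbT.
    rewrite -icontent_bisection// -mA0; apply: le_icontent => // _ [h /WA Wh <-].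
    exact: Wh.
have := icontentT im; rewrite -(_ : D = setT) ?mD0; last by apply/seteqP; split.
by move/esym/eqP; rewrite oner_eq0.
Qed.

Lemma icontent_exists : exists m, icontent m.
Proof.
(* No restriction is put on the orbits, so the base point [point] will do. *)
have [|mu [imu _]] := @limit_measure R _ _ _ _ _ _ _ etG scG cG0 tG0 (fun _ _ => True).
  move=> C eps cC e0; have [K [eK dK]] := afG cC e0.
  by exists K, point; split=> //; exact: dK.
by exists (fun A => fine (mu A)); exact: invariant_content_fine.
Qed.

Lemma comparison U V : clopen U -> clopen V ->
  (forall m, icontent m -> m U < m V) ->
  exists W, [/\ bisection r s W, r @` W = U & s @` W `<=` V].
Proof.
move=> cU cV UV.
have [K [[[cK oK Ku KM KV] pK] UK]] : exists K, elementary_subgroupoid r s u mul inv K /\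
    forall x, (scard (U `&` Korbit r s K x) < scard (V `&` Korbit r s K x))%N.
  apply: contrapT => nK.
  (* If every [K] has an orbit violating the strict inequality, the limit measure over such orbits
     contradicts the hypothesis on [U] and [V]. *)
  pose Bad K x := (scard (V `&` Korbit r s K x) <= scard (U `&` Korbit r s K x))%N.
  have [|mu [imu muP]] := @limit_measure R _ _ _ _ _ _ _ etG scG cG0 tG0 Bad.
    move=> C eps cC e0; have [K [eK dK]] := afG cC e0.
    apply: contrapT => nx; apply: nK; exists K; split=> // x.
    rewrite ltnNge; apply/negP => bad; apply: nx; exists K, x; split=> //.
    exact: dK.
  have im := invariant_content_fine imu.
  have := UV _ im; rewrite ltNge => /negP; apply; rewrite -lee_fin.
  by rewrite !fineK ?fin_num_measure//; [exact: muP|exact: clopen_borel|exact: clopen_borel].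
have [W [bW WK WU WV Wmax]] := greedy_matching etG cG0 tG0 cK oK (@subset_refl _ K) cU cV.
exists W; split=> //; apply/seteqP; split=> // x Ux; apply: contrapT => nWx.
have fK := finite_Korbit etG x cK.
(* For an unmatched [x] in [U], the arrow of [K] with range [x] and source [y] forces [y] to be
   matched already. Following the matching then injects the points of [V] in [K(x)] into those of
   [U], against the strict count. *)
have VW y : V y -> Korbit r s K x y -> (s @` W) y.
  move=> Vy [k [Kk kx] ky].
  have := Wmax (inv k) (KV k Kk); rewrite (gpd_r_inv gG) (gpd_s_inv gG) kx ky.
  by move=> /(_ Ux Vy)[].
have /choice[f fP] y : exists g, V y -> Korbit r s K x y -> W g /\ s g = y.
  have [[Vy Ky]|n] := pselect (V y /\ Korbit r s K x y).
    by have [g Wg gy] := VW y Vy Ky; exists g.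
  by exists (u y) => Vy Ky; exfalso; apply: n.
have := UK x; rewrite ltnNge => /negP; apply.
have [_ _ GW] := bW.
apply: (@scard_inj _ _ _ _ (r \o f)).
- exact: finite_setIr.
- exact: finite_setIr.
- move=> y y' /set_mem[Vy Ky] /set_mem[Vy' Ky'] /= E.
  have [Wf fy] := fP y Vy Ky; have [Wf' fy'] := fP y' Vy' Ky'.
  by rewrite -fy -fy' (Gset_r_inj GW Wf Wf' E).
- move=> _ [y [Vy Ky] <-]; have [Wf fy] := fP y Vy Ky.
  split; first by apply: WU; exists (f y).
  have [k [Kk kx] ky] := Ky; have fk : s (f y) = r k by rewrite fy ky.
  exists (mul (f y) k); last by rewrite (gpd_r_mul gG).
  by split; [apply: KM => //; exact: WK|rewrite (gpd_s_mul gG)].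
Qed.

End Comparison.

(** * Partial homeomorphisms carried by sets of arrows *)

(* The partial map [p g |-> q g], [g] in [T], is continuous. *)
Definition continuous_along {G G0 : topologicalType} (p q : G -> G0) (T : set G) :=
  forall g, T g -> forall N : set G0, open N -> N (q g) ->
  exists M : set G0, [/\ open M, M (p g) & forall h, T h -> M (p h) -> N (q h)].

(** The arrows of [T] carry a homeomorphism from [U] onto [V]. [T] need not be open, because a
    limiting arrow may have been added, so continuity is demanded in both directions. *)
Definition transfers {G G0 : topologicalType} (r s : G -> G0) (U V : set G0) (T : set G) :=
  [/\ Gset r s T, r @` T = U, s @` T = V, continuous_along r s T & continuous_along s r T].

Section Exhaustion.
Context {G : Type} {X : Type} (f : G -> X) (A : nat -> set X) (W : nat -> set G) (g0 : G).
Context (Anext : forall n, A n.+1 `<=` A n) (A0 : forall n, A n (f g0)).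
Context (fW : forall n, f @` W n = A n `\` A n.+1) (injW : forall n, set_inj (W n) f).

(** Used with [f] equal to [r] and to [s]: each [W n] covers one layer of a decreasing sequence, and
    [g0] lies over the point that is never removed. *)
Let T := \bigcup_n W n `|` [set g0].

Lemma exhaustion_decr m n : (m <= n)%N -> A n `<=` A m.
Proof.
elim: n => [|n ih]; first by rewrite leqn0 => /eqP ->.
rewrite leq_eqVlt => /orP[/eqP -> //|]; rewrite ltnS => /ih.
exact: subset_trans.
Qed.

Lemma exhaustion_layer n g : W n g -> A n (f g) /\ ~ A n.+1 (f g).
Proof. by move=> Wg; have : (f @` W n) (f g) by [exists g]; rewrite fW. Qed.

(** A point other than [f g0] drops out of the sequence at some stage [k] and so lies in the layer
    covered by [W k]. *)
Lemma exhaustion_image : (forall x, (forall n, A n x) -> x = f g0) -> f @` T = A 0%N.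
Proof.
move=> capA; apply/seteqP; split=> [_ [g [[n _ Wg]|->] <-]|x A0x].
- exact: (exhaustion_decr (leq0n n)) (exhaustion_layer Wg).1.
- exact: A0.
have [/capA ->|/existsNP[n nA]] := pselect (forall n, A n x).
  by exists g0 => //; right.
have [k [Ak nAk]] : exists k, A k x /\ ~ A k.+1 x.
  elim: n nA => // n ih nA; have [An|/ih//] := pselect (A n x).
  by exists n.
have : (f @` W k) x by rewrite fW.
by move=> [g Wg <-]; exists g => //; left; exists k.
Qed.

Lemma exhaustion_inj : set_inj T f.
Proof.
have aux m n g h : (m < n)%N -> W m g -> W n h -> f g <> f h.
  move=> mn Wg Wh E; apply: (exhaustion_layer Wg).2; rewrite E.
  exact: exhaustion_decr mn _ (exhaustion_layer Wh).1.
move=> g h /set_mem[[m _ Wg]|->] /set_mem[[n _ Wh]|->] // E.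
- case: (ltngtP m n) => mn.
  + by case: (aux m n g h).
  + by case: (aux n m h g).
  + by subst n; apply: (injW (n := m)) => //; exact/mem_set.
- by case: (exhaustion_layer Wg).2; rewrite E.
- by case: (exhaustion_layer Wh).2; rewrite -E.
Qed.

(** This serves continuity at [g0]: arrows of [T] over a late set [A n] come from late layers. *)
Lemma exhaustion_tail n g : T g -> A n (f g) ->
  (exists2 m, (n <= m)%N & W m g) \/ g = g0.
Proof.
move=> [[m _ Wg]|->] Ang; [left|by right].
exists m => //; rewrite leqNgt; apply/negP => mn.
by apply: (exhaustion_layer Wg).2; exact: exhaustion_decr mn _ Ang.
Qed.

End Exhaustion.

(** Over the open set of points [p k], with [k] in [W] and [q k] in [N], injectivity of [p] on [T]
    leaves no arrow of [T] except those [k]. *)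
Lemma open_Gset_continuous_along {G G0 : topologicalType} (p q : G -> G0) (W T : set G) g :
  (forall O, open O -> open (p @` O)) -> continuous q -> set_inj T p -> open W ->
  W `<=` T -> W g -> forall N : set G0, open N -> N (q g) ->
  exists M : set G0, [/\ open M, M (p g) & forall h, T h -> M (p h) -> N (q h)].
Proof.
move=> op cq injT oW WT Wg N oN Nq.
have oWN : open (W `&` q @^-1` N).
  by apply: openI => //; move: N oN {Nq}; apply/continuousP.
exists (p @` (W `&` q @^-1` N)); split; [exact: op|by exists g|].
move=> h Th [k [Wk Nk] kh]; rewrite -(injT k h)//; apply/mem_set => //.
exact: WT.
Qed.

Lemma transfers_bisection {G : topologicalType} {G0 : ptopologicalType}
    (r s : G -> G0) u mul inv (W : set G) :
  is_etale_groupoid r s u mul inv -> bisection r s W ->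
  transfers r s (r @` W) (s @` W) W.
Proof.
move=> etG [_ oW GW]; split=> // g Wg; have [ir is_] := GW.
  exact: (@open_Gset_continuous_along _ _ r s W W g (r_open etG) (s_continuous etG)).
exact: (@open_Gset_continuous_along _ _ s r W W g (s_open etG) (r_continuous etG)).
Qed.

Section Involution.
Context {G : topologicalType} {G0 : ptopologicalType}.
Context {r s : G -> G0} {u : G0 -> G} {mul : G -> G -> G} {inv : G -> G}.
Context (etG : is_etale_groupoid r s u mul inv).
Context {U V : set G0} (cU : clopen U) (cV : clopen V) (UV0 : U `&` V = set0).

Let gG : is_groupoid r s u mul inv := etale_groupoid etG.

(** The map exchanges [r g] and [s g] for [g] in [T] and fixes all other points. As [U], [V] and the
    rest are clopen, continuity is checked on each piece separately. *)
Lemma transfers_involution T : transfers r s U V T -> exists gamma,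
  [/\ full_group r s gamma, gamma @` U = V, gamma \o gamma = id &
      forall x, ~ (U `|` V) x -> gamma x = x].
Proof.
move=> [GT rT sT crs csr].
have Ur g : T g -> U (r g) by rewrite -rT => Tg; exists g.
have Vs g : T g -> V (s g) by rewrite -sT => Tg; exists g.
have nUV x : U x -> V x -> False by move=> Ux Vx; have : (U `&` V) x by []; rewrite UV0.
(* The graph of the exchange: its symmetry makes [gamma] an involution; disjointness of [U] and [V]
   and injectivity on [T] make it single-valued. *)
pose rel x y := [\/ exists g, [/\ T g, r g = x & s g = y],
                    exists g, [/\ T g, s g = x & r g = y] |
                    ~ (U `|` V) x /\ y = x].
have relC x y : rel x y -> rel y x.
  by move=> [[g [? ? ?]]|[g [? ? ?]]|[n ->]];
    [apply: Or32; exists g|apply: Or31; exists g|apply: Or33].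
have relU x y z : rel x y -> rel x z -> y = z.
  move=> [[g [Tg gx gy]]|[g [Tg gx gy]]|[n ->]] [[h [Th hx hz]]|[h [Th hx hz]]|[n' ->]] //.
  - by rewrite -gy -hz (Gset_r_inj GT Tg Th) ?gx.
  - by case: (nUV x); [rewrite -gx; exact: Ur|rewrite -hx; exact: Vs].
  - by case: n'; left; rewrite -gx; exact: Ur.
  - by case: (nUV x); [rewrite -hx; exact: Ur|rewrite -gx; exact: Vs].
  - by rewrite -gy -hz (Gset_s_inj GT Tg Th) ?gx.
  - by case: n'; right; rewrite -gx; exact: Vs.
  - by case: n; left; rewrite -hx; exact: Ur.
  - by case: n; right; rewrite -hx; exact: Vs.
have /choice[gamma gP] x : exists y, rel x y.
  have [Ux|nU] := pselect (U x).
    by have [g Tg gx] : (r @` T) x; [rewrite rT|exists (s g); apply: Or31; exists g].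
  have [Vx|nV] := pselect (V x).
    by have [g Tg gx] : (s @` T) x; [rewrite sT|exists (r g); apply: Or32; exists g].
  by exists x; apply: Or33; split=> // -[].
have gammaE x y : rel x y -> gamma x = y by exact: relU.
have gK : cancel gamma gamma by move=> x; apply: gammaE; exact: relC.
have gr g : T g -> gamma (r g) = s g by move=> Tg; apply: gammaE; apply: Or31; exists g.
have gs g : T g -> gamma (s g) = r g by move=> Tg; apply: gammaE; apply: Or32; exists g.
have gid x : ~ (U `|` V) x -> gamma x = x by move=> n; apply: gammaE; exact: Or33.
have local_cont (p q : G -> G0) (D : set G0) g : open D -> p @` T = D ->
    (forall g, T g -> gamma (p g) = q g) -> continuous_along p q T -> T g ->
    forall N, open N -> N (gamma (p g)) -> nbhs (p g) (gamma @^-1` N).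
  move=> oD pT gp cpq Tg N oN; rewrite gp// => Nq.
  have [M [oM Mg MN]] := cpq g Tg N oN Nq.
  rewrite nbhsE; exists (M `&` D); first by split; [exact: openI|split=> //; rewrite -pT; exists g].
  by move=> x [Mx]; rewrite -pT => -[h Th hx]; rewrite /= -hx gp//; apply: MN; rewrite ?hx.
have cg : continuous gamma.
  move=> x N; rewrite nbhsE => -[N' [oN' N'x] N'N]; apply: (@filterS _ (nbhs x) _ (gamma @^-1` N')).
    exact: preimage_subset.
  have [Ux|nU] := pselect (U x).
    have [g Tg gx] : (r @` T) x by rewrite rT.
    by rewrite -gx in N'x *; apply: (local_cont r s U) => //; exact: cU.1.
  have [Vx|nV] := pselect (V x).
    have [g Tg gx] : (s @` T) x by rewrite sT.
    by rewrite -gx in N'x *; apply: (local_cont s r V) => //; exact: cV.1.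
  have nx : ~ (U `|` V) x by case.
  rewrite gid// in N'x; rewrite nbhsE; exists (N' `&` ~` (U `|` V)).
    split=> //; apply: openI => //; apply: closed_openC; apply: closedU; [exact: cU.2|exact: cV.2].
  by move=> y [N'y ny]; rewrite /= gid.
exists gamma; split.
- split; first by split=> //; exists gamma.
  move=> x; case: (gP x) => [[g [_ gx gy]]|[g [_ gx gy]]|[_ ->]].
  + by exists g.
  + by exists (inv g); rewrite (gpd_r_inv gG) (gpd_s_inv gG).
  + by exists (u x); rewrite (gpd_r_unit gG) (gpd_s_unit gG).
- by rewrite -rT -sT image_comp; apply: eq_imagel => g Tg /=; exact: gr.
- by apply/funext.
- exact: gid.
Qed.

End Involution.

(** * Matching clopen sets of equal measure, with and without isolated points *)

Section EqualMeasures.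
Context {R : realType} {G : topologicalType} {G0 : ptopologicalType}.
Context {r s : G -> G0} {u : G0 -> G} {mul : G -> G -> G} {inv : G -> G}.
Context (etG : is_etale_groupoid r s u mul inv) (scG : @second_countable G).
Context (cG0 : compact [set: G0]) (tG0 : totally_disconnected [set: G0]).
Context (afG : almost_finite r s u mul inv R) (minG : minimal_groupoid r s).
Implicit Types (W C K O T : set G) (A B D U V N M : set G0) (g h k : G) (x y : G0).
Implicit Types m : set G0 -> R.

Let gG : is_groupoid r s u mul inv := etale_groupoid etG.
Local Notation icontent := (invariant_content r s).

Definition equidistributed A B := forall m, icontent m -> m A = m B.

(** Minimality joins every point to [x] by an arrow, so all points are isolated and the compact unit
    space is finite. *)
Lemma transfers_isolated U V x : open [set x] -> clopen U -> clopen V ->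
  equidistributed U V -> exists T, transfers r s U V T.
Proof.
move=> ox cU cV eUV.
have /choice[a aP] y : exists g, s g = y /\ r g = x.
  by have [|g [gy gx]] := minimal_arrow minG y ox; [exists x|exists g].
have opt y : open [set y].
  have [ay ax] := aP y.
  have [W [[_ oW GW] Wa Wx]] := bisection_nbhs etG cG0 tG0 (open_preim_r etG ox) ax.
  rewrite (_ : [set y] = s @` W); first exact: s_open etG _ oW.
  apply/seteqP; split=> [_ ->|_ [g Wg <-]]; first by exists (a y).
  by rewrite /= (Gset_r_inj GW Wg Wa) ?ay// (Wx g Wg).
have fG0 : finite_set [set: G0].
  apply: (@compact_ind _ _ (@finite_set G0) cG0) => //.
  - by move=> A B; exact: sub_finite_set.
  - by move=> A B fA fB; rewrite finite_setU.
  - by move=> y _; exists [set y]; split=> //; exact: opt.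
(* [C] holds an arrow between any two points, passing through [x]; so a greedy matching exhausts [U]
   or [V]. *)
pose C := (fun p : G0 * G0 => mul (inv (a p.1)) (a p.2)) @` ([set: G0] `*` [set: G0]).
have cC : compact C by apply: finite_compact; apply: finite_image; exact: finite_setX.
have [W [bW _ WU WV Wmax]] :=
  greedy_matching etG cG0 tG0 cC openT (@subsetT _ C) cU cV.
have cr := bisection_clopen_r etG bW; have cs := bisection_clopen_s etG bW.
have Wfull y z : U y -> V z -> (r @` W) y \/ (s @` W) z.
  move=> Uy Vz; have [ay ax] := aP y; have [az axz] := aP z.
  have E : s (inv (a y)) = r (a z) by rewrite (gpd_s_inv gG) ax axz.
  have := Wmax (mul (inv (a y)) (a z)).
  rewrite (gpd_r_mul gG)// (gpd_s_mul gG)// (gpd_r_inv gG) ay az; apply=> //.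
  by exists (y, z).
have [m im] := icontent_exists etG scG cG0 tG0 afG.
(* The remainders have equal measure; one of them is empty, and positivity empties the other. *)
have mD : m (U `\` r @` W) = m (V `\` s @` W).
  by rewrite !(icontentD im)// (eUV m im) (icontent_bisection etG im bW).
have gt0 := icontent_gt0 etG cG0 tG0 minG im.
have rW : r @` W = U.
  apply/seteqP; split=> // y Uy; apply: contrapT => nWy.
  have VW : V `\` s @` W = set0.
    by rewrite -subset0 => z [Vz nWz]; case: (Wfull y z Uy Vz).
  have : 0 < m (U `\` r @` W) by apply: gt0; [exact: clopenD|exists y].
  by rewrite mD VW (icontent0 im) ltxx.
have sW : s @` W = V.
  apply/seteqP; split=> // y Vy; apply: contrapT => nWy.
  have : 0 < m (V `\` s @` W) by apply: gt0; [exact: clopenD|exists y].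
  by rewrite -mD rW setDv (icontent0 im) ltxx.
by exists W; rewrite -rW -sW; exact: transfers_bisection etG bW.
Qed.

(** An arrow joins [y] to a point of [A], which contains a second point [z]. A bisection around that
    arrow, with range in a clopen subset of [A] missing [z], has a source [B] that is small for all
    invariant contents simultaneously. *)
Lemma small_clopen_nbhs A M y : (forall x, ~ open [set x]) -> clopen A ->
  A !=set0 -> clopen M -> M y ->
  exists B, [/\ clopen B, B y, B `<=` M & forall m, icontent m -> m B < m A].
Proof.
move=> noiso cA A0 cM My.
have [g [gy Ag]] := minimal_arrow minG y cA.1 A0.
have [z [Az zg]] : exists z, A z /\ z <> r g.
  apply: contrapT => nz; apply: (noiso (r g)); rewrite -(_ : A = [set r g]); first exact: cA.1.
  apply/seteqP; split=> [z Az|_ ->//]; apply: contrapT => zg; apply: nz.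
  by exists z.
have oAz : open (A `\ z).
  rewrite setDE; apply: openI; first exact: cA.1.
  apply: closed_openC; apply: accessible_closed_set1.
  exact/hausdorff_accessible/(unit_space_hausdorff etG).
have [|D [cD Dg DA]] := clopen_nbhs etG cG0 tG0 oAz (x := r g).
  by split=> // E; exact: zg.
have oDM : open (r @^-1` D `&` s @^-1` M).
  by apply: openI; [apply: (open_preim_r etG); exact: cD.1|apply: (open_preim_s etG); exact: cM.1].
have [|W [bW Wg WDM]] := bisection_nbhs etG cG0 tG0 oDM (g := g).
  by split=> //=; rewrite gy.
have cr := bisection_clopen_r etG bW; have cs := bisection_clopen_s etG bW.
exists (s @` W); split=> //; first by exists g.
  by move=> _ [h /WDM[_ ?] <-].
move=> m im; rewrite -(icontent_bisection etG im bW).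
have rWD : m (r @` W) <= m D by apply: (le_icontent im) => // _ [h /WDM[? _] <-].
have DsA : D `<=` A by move=> w /DA[].
have : 0 < m (A `\` D).
  apply: (icontent_gt0 etG cG0 tG0 minG im); first exact: clopenD.
  by exists z; split=> // /DA[_]; apply.
by rewrite (icontentD im)//; lra.
Qed.

Definition transfer_step A B A' B' W := [/\ bisection r s W, clopen A', clopen B',
  A' `<=` A & B' `<=` B] /\ (r @` W = A `\` A' /\ s @` W = B `\` B').

Lemma equidistributed_step A B A' B' W : clopen A -> clopen B ->
  transfer_step A B A' B' W -> equidistributed A B -> equidistributed A' B'.
Proof.
move=> cA cB [[bW cA' cB' AA BB] [rW sW]] eAB m im.
have := icontent_bisection etG im bW.
by rewrite rW sW !(icontentD im)// (eAB m im); lra.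
Qed.

(** Let [B1] be a neighbourhood of [y] smaller than the part of [A] in [N]. Then the part of [A]
    outside [N] has smaller measure than [B] without [B1], and comparison moves it there without
    touching [y]. *)
Lemma transfer_half_step A B N x y : (forall x, ~ open [set x]) ->
  clopen A -> clopen B -> clopen N -> A x -> N x -> B y -> equidistributed A B ->
  exists A' B' W, transfer_step A B A' B' W /\ [/\ A' x, B' y & A' `<=` N].
Proof.
move=> noiso cA cB cN Ax Nx By eAB.
have cAN : clopen (A `&` N) by exact: clopenI.
have AN0 : A `&` N !=set0 by exists x.
have [B1 [cB1 B1y B1B B1lt]] := small_clopen_nbhs noiso cAN AN0 cB By.
have cAD := clopenD cA cAN; have cBD := clopenD cB cB1.
have [|W [bW rW sW]] := comparison etG scG cG0 tG0 afG cAD cBD.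
  move=> m im; rewrite !(icontentD im)//.
  by have := B1lt m im; have := eAB m im; lra.
exists (A `&` N), (B `\` s @` W), W; split.
  split; split=> //.
  - by apply: clopenD => //; exact: bisection_clopen_s etG _ bW.
  - by rewrite setDD setIidr// => z /sW[].
split=> //; split=> // /sW[]; exact.
Qed.

(** One half step shrinks the [A] side, a second with the roles exchanged shrinks the [B] side; its
    bisection is inverted before the two are joined. *)
Lemma transfer_full_step A B N M x y : (forall x, ~ open [set x]) ->
  clopen A -> clopen B -> clopen N -> clopen M ->
  A x -> N x -> B y -> M y -> equidistributed A B ->
  exists A' B' W, transfer_step A B A' B' W /\ [/\ A' x, B' y, A' `<=` N & B' `<=` M].
Proof.
move=> noiso cA cB cN cM Ax Nx By My eAB.
have [A1 [B1 [W1 [st1 [A1x B1y A1N]]]]] := transfer_half_step noiso cA cB cN Ax Nx By eAB.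
have eAB1 := equidistributed_step cA cB st1 eAB.
have [[bW1 cA1 cB1 A1A B1B] [rW1 sW1]] := st1.
have eBA1 : equidistributed B1 A1 by move=> m im; rewrite eAB1.
have [B2 [A2 [W2 [st2 [B2y A2x B2M]]]]] := transfer_half_step noiso cB1 cA1 cM B1y My A1x eBA1.
have [[bW2 cB2 cA2 B2B1 A2A1] [rW2 sW2]] := st2.
have layers (P Q S : set G0) : S `<=` Q -> Q `<=` P ->
    (P `\` Q) `|` (Q `\` S) = P `\` S /\ (P `\` Q) `&` (Q `\` S) = set0.
  move=> SQ QP; split; last by rewrite -subset0 => z [[_ nQ] [Qz _]].
  apply/seteqP; split=> [z [[Pz nQ]|[Qz nS]]|z [Pz nS]].
  - by split=> // /SQ.
  - by split=> //; exact: QP.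
  - by have [Qz|nQ] := pselect (Q z); [right|left].
have [eA dA] := layers A A1 A2 A2A1 A1A; have [eB dB] := layers B B1 B2 B2B1 B1B.
exists A2, B2, (W1 `|` inv @` W2); split; last by split=> //; exact: subset_trans A1N.
split; last first.
  by rewrite !image_setU (r_inv_image etG) (s_inv_image etG) rW1 sW1 rW2 sW2.
split=> //; [|exact: subset_trans A1A|exact: subset_trans B1B].
apply: bisectionU => //; first exact: bisection_inv etG _ bW2.
  by rewrite (r_inv_image etG) rW1 sW2.
by rewrite (s_inv_image etG) sW1 rW2.
Qed.

Lemma transfers_perfect U V : (forall x, ~ open [set x]) -> clopen U -> clopen V ->
  U !=set0 -> V !=set0 -> equidistributed U V -> exists T, transfers r s U V T.
Proof.
move=> noiso cU cV [x0 Ux0] V0 eUV.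
have [g [gx Vg]] := minimal_arrow minG x0 cV.1 V0.
(* Minimality prescribes the source of [g], whereas the limiting arrow must have range [x0]. *)
pose g0 := inv g.
have rg0 : r g0 = x0 by rewrite (gpd_r_inv gG).
have sg0 : V (s g0) by rewrite (gpd_s_inv gG).
have [N [cN NP]] := clopen_nbhs_seq etG scG cG0 tG0 (r g0).
have [M [cM MP]] := clopen_nbhs_seq etG scG cG0 tG0 (s g0).
pose good (p : set G0 * set G0) := [/\ clopen p.1, clopen p.2, p.1 (r g0), p.2 (s g0) &
  equidistributed p.1 p.2].
have /choice[f fP] (q : nat * (set G0 * set G0)) :
    exists t : (set G0 * set G0) * set G, good q.2 ->
    [/\ good t.1, transfer_step q.2.1 q.2.2 t.1.1 t.1.2 t.2,
        t.1.1 `<=` N q.1 & t.1.2 `<=` M q.1].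
  have [[cA cB Ax By eAB]|ng] := pselect (good q.2); last by exists ((set0, set0), set0).
  have [cNq Nq] := cN q.1; have [cMq Mq] := cM q.1.
  have [A' [B' [W [st [A'x B'y A'N B'M]]]]] :=
    transfer_full_step noiso cA cB cNq cMq Ax Nq By Mq eAB.
  exists ((A', B'), W) => _; split=> //=; have [[bW cA' cB' _ _] _] := st.
  by split=> //; exact: equidistributed_step st eAB.
(* [seq n] holds the remainders of both sides before stage [n]; [W n] below matches what that stage
   removes. *)
pose fix seq n := if n is n'.+1 then (f (n', seq n')).1 else (U, V).
have seq_good n : good (seq n).
  elim: n => [|n ih] /=; first by split=> //=; rewrite rg0.
  by have [] := fP (n, seq n) ih.
pose A n := (seq n).1; pose B n := (seq n).2; pose W n := (f (n, seq n)).2.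
have step n : transfer_step (A n) (B n) (A n.+1) (B n.+1) (W n).
  by have [] := fP (n, seq n) (seq_good n).
have AN n : A n.+1 `<=` N n by have [] := fP (n, seq n) (seq_good n).
have BM n : B n.+1 `<=` M n by have [] := fP (n, seq n) (seq_good n).
have Anext n : A n.+1 `<=` A n by have [[]] := step n.
have Bnext n : B n.+1 `<=` B n by have [[]] := step n.
have A0 n : A n (r g0) by have [] := seq_good n.
have B0 n : B n (s g0) by have [] := seq_good n.
have bW n : bisection r s (W n) by have [[]] := step n.
have rW n : r @` W n = A n `\` A n.+1 by have [_ []] := step n.
have sW n : s @` W n = B n `\` B n.+1 by have [_ []] := step n.
have injr n : set_inj (W n) r by have [_ _ []] := bW n.
have injs n : set_inj (W n) s by have [_ _ []] := bW n.
(* The remainders enter every neighbourhood of the limiting point, so by the Hausdorff property they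
   have no other common point. *)
have cap (Q : nat -> set G0) (P : nat -> set G0) z :
    (forall O : set G0, open O -> O z -> exists n, P n `<=` O) ->
    (forall n, Q n.+1 `<=` P n) -> forall y, (forall n, Q n y) -> y = z.
  move=> PP QP y Qy; apply: contrapT => /eqP yz.
  have := unit_space_hausdorff etG; rewrite open_hausdorff => /(_ _ _ yz).
  move=> [[D1 D2] /= [/set_mem D1y /set_mem D2z] [_ oD2 /eqP D12]].
  have [n PO] := PP D2 oD2 D2z.
  have : (D1 `&` D2) y by split=> //; apply/PO/QP.
  by rewrite D12.
pose T := \bigcup_n W n `|` [set g0].
have injrT : set_inj T r by exact: exhaustion_inj Anext A0 rW injr.
have injsT : set_inj T s by exact: exhaustion_inj Bnext B0 sW injs.
have WT n : W n `<=` T by move=> h Wh; left; exists n.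
exists T; split.
- by split.
- exact: exhaustion_image Anext A0 rW (cap A N _ NP AN).
- exact: exhaustion_image Bnext B0 sW (cap B M _ MP BM).
- move=> h [[n _ Wh]|->].
    have [_ oW _] := bW n.
    exact: (open_Gset_continuous_along (r_open etG) (s_continuous etG) injrT oW (WT n) Wh).
  move=> O oO Oy; have [n MO] := MP O oO Oy.
  (* Arrows of [T] over [A n.+1] are [g0] or lie in layers from [n.+1] on, so their sources lie in
     [B n.+1], inside [M n]. The shift arises because stage [n] shrinks the next remainder into
     [M n]. *)
  exists (A n.+1); split=> //; first by have [[]] := seq_good n.+1.
  move=> k Tk Ak; have [[m nm Wk]|->//] := exhaustion_tail Anext rW Tk Ak.
  apply/MO/BM; apply: (exhaustion_decr Bnext nm).
  exact: (exhaustion_layer sW Wk).1.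
- move=> h [[n _ Wh]|->].
    have [_ oW _] := bW n.
    exact: (open_Gset_continuous_along (s_open etG) (r_continuous etG) injsT oW (WT n) Wh).
  move=> O oO Oy; have [n NO] := NP O oO Oy.
  exists (B n.+1); split=> //; first by have [_ []] := seq_good n.+1.
  move=> k Tk Bk; have [[m nm Wk]|->//] := exhaustion_tail Bnext sW Tk Bk.
  apply/NO/AN; apply: (exhaustion_decr Anext nm).
  exact: (exhaustion_layer rW Wk).1.
Qed.

Lemma equidistributed_set0 U : clopen U -> equidistributed U set0 -> U = set0.
Proof.
move=> cU eU; apply: contrapT => /eqP/set0P U0.
have [m im] := icontent_exists etG scG cG0 tG0 afG.
have := icontent_gt0 etG cG0 tG0 minG im cU U0.
by rewrite (eU m im) (icontent0 im) ltxx.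
Qed.

Lemma equidistributed_transfers U V : clopen U -> clopen V ->
  equidistributed U V -> exists T, transfers r s U V T.
Proof.
move=> cU cV eUV.
have [[x ox]|noiso] := pselect (exists x, open [set x : G0]).
  exact: transfers_isolated ox cU cV eUV.
have niso x : ~ open [set x : G0] by move=> ox; apply: noiso; exists x.
have empty : U = set0 -> V = set0 -> exists T, transfers r s U V T.
  move=> -> ->; exists set0; rewrite -{1}(image_set0 r) -(image_set0 s).
  exact: transfers_bisection etG bisection0.
have [U0|/set0P U0] := eqVneq U set0.
  apply: empty => //; apply: equidistributed_set0 => // m im.
  by rewrite -eUV// U0.
have [V0|/set0P V0] := eqVneq V set0; last exact: transfers_perfect.
by apply: empty => //; apply: equidistributed_set0; rewrite // -V0.
Qed.

End EqualMeasures.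

(** * The equivalence, with an involution in the full group *)

Theorem theorem6p11 (R : realType) (G : topologicalType) (G0 : ptopologicalType)
  (r s : G -> G0) (u : G0 -> G) (mul : G -> G -> G) (inv : G -> G) :
  is_etale_groupoid r s u mul inv ->
  @second_countable G ->
  compact [set: G0] ->
  totally_disconnected [set: G0] ->
  almost_finite r s u mul inv R ->
  minimal_groupoid r s ->
  forall U V : set G0, clopen U -> clopen V ->
    ((exists gamma, full_group r s gamma /\ gamma @` U = V) <->
     (forall mu : probability (Borel G0) R,
        invariant_measure r s mu -> mu U = mu V)) /\
    ((exists gamma, full_group r s gamma /\ gamma @` U = V) ->
     exists gamma, [/\ full_group r s gamma, gamma @` U = V,
        gamma \o gamma = id &
        forall x, ~ (U `|` V) x -> gamma x = x]).
Proof.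
move=> etG scG cG0 tG0 afG minG U V cU cV.
pose eqmu := forall mu : probability (Borel G0) R, invariant_measure r s mu -> mu U = mu V.
have full_eqmu : (exists gamma, full_group r s gamma /\ gamma @` U = V) -> eqmu.
  move=> [gamma [fg gU]] mu imu; rewrite -gU; apply/esym.
  by apply: (full_group_invariant etG scG cG0 tG0 imu fg); exact: clopen_borel.
have eqmu_full : eqmu -> exists gamma, [/\ full_group r s gamma, gamma @` U = V,
    gamma \o gamma = id & forall x, ~ (U `|` V) x -> gamma x = x].
  move=> eUV; have cI := clopenI cU cV.
  have cUV := clopenD cU cV; have cVU := clopenD cV cU.
  (* The intersection of [U] and [V] is to stay fixed, so only the two differences are exchanged;
     they are disjoint and still have equal measure. *)
  have eD : @equidistributed R _ _ r s (U `\` V) (V `\` U).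
    move=> m im; have mUV : m U = m V.
      by have [mu [imu muE]] := im; apply: EFin_inj; rewrite -!muE//; exact: eUV.
    have -> : U `\` V = U `\` (U `&` V) by rewrite setDIr setDv set0U.
    have -> : V `\` U = V `\` (U `&` V) by rewrite setDIr setDv setU0.
    by rewrite !(icontentD im)// mUV.
  have [T tT] := equidistributed_transfers etG scG cG0 tG0 afG minG cUV cVU eD.
  have dUV : (U `\` V) `&` (V `\` U) = set0 by rewrite -subset0 => x [[_ nV] [Vx _]].
  have [gamma [fg gUV gg gid]] := transfers_involution etG cUV cVU dUV tT.
  exists gamma; split=> //.
    have gI x : U x -> V x -> gamma x = x.
      by move=> Ux Vx; apply: gid => -[[]|[]].
    apply/seteqP; split=> [_ [x Ux <-]|y Vy].
      have [Vx|nVx] := pselect (V x); first by rewrite gI.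
      by have [] : (V `\` U) (gamma x) by rewrite -gUV; exists x.
    have [Uy|nUy] := pselect (U y); first by exists y => //; exact: gI.
    by have : (V `\` U) y by []; rewrite -gUV => -[x [Ux _] <-]; exists x.
  by move=> x nx; apply: gid => -[[Ux _]|[Vx _]]; apply: nx; [left|right].
split; last by move=> /full_eqmu/eqmu_full.
by split=> // /eqmu_full[gamma [? ? _ _]]; exists gamma.
Qed.
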